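(* Let $\lambda\ge 0$ and let $\Sigma^2\subset\mathbb{R}^3$ be a smooth closed embedded $\lambda$-hypersurface, i.e. $H-\frac{\langle x,\mathbf{n}\rangle}{2}=\lambda$ on $\Sigma$. If the second fundamental form of $\Sigma$ has constant length, i.e. $|A|$ is constant on $\Sigma$, then $\Sigma$ is a round sphere.
   Context: Closed means compact without boundary; hypersurfaces are connected. For a smooth surface $\Sigma^2\subset\mathbb{R}^3$, $x$ is the position vector, $\mathbf{n}$ is the outward pointing unit normal, $H=\mathrm{div}_\Sigma\mathbf{n}$ is the mean curvature (the sum of the principal curvatures, so $H=2/r$ on the sphere of radius $r$), and $A$ is the second fundamental form with coefficients $a_{ij}=\langle\nabla_{e_i}e_j,\mathbf{n}\rangle$ in a local orthonormal frame, with $|A|^2=\sum_{i,j}a_{ij}^2$. *)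

(* Defs.v *)
From HB Require Import structures.
From mathcomp Require Import all_boot all_order all_algebra.
From mathcomp Require Import all_classical all_reals all_analysis.

Set Implicit Arguments.
Unset Strict Implicit.
Unset Printing Implicit Defensive.

Import Order.TTheory GRing.Theory Num.Theory.
Import numFieldTopology.Exports numFieldNormedType.Exports.

Local Open Scope classical_set_scope.
Local Open Scope ring_scope.

(* The library norm on 'rV[R]_n is the sup norm: it is used here only for the
   topology, for boundedness and for differentiability.  All metric notions go
   through the Euclidean inner product. *)
Definition dot (R : realType) (n : nat) (x y : 'rV[R]_n) : R :=
  \sum_(i < n) x 0 i * y 0 i.

Section Smooth.
Context {R : realType} {V W : normedModType R}.

(* For U open and V finite-dimensional this is the class C^k on U: the
   differential is C^k iff all its evaluations x |-> 'd f x v = 'D_v f x are. *)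
Fixpoint Ck (k : nat) (U : set V) (f : V -> W) : Prop :=
  match k with
  | 0 => forall x, U x -> {for x, continuous f}
  | k'.+1 => (forall x, U x -> differentiable f x) /\
             forall v : V, Ck k' U (fun x => 'D_v f x)
  end.

Definition smooth (U : set V) (f : V -> W) : Prop := forall k, Ck k U f.

End Smooth.

Section Surfaces.
Context {R : realType}.
Implicit Types (S : set 'rV[R]_3) (p q v : 'rV[R]_3) (X : 'rV[R]_3 -> 'rV[R]_3).

Definition local_parametrization S (U : set 'rV[R]_2) (V : set 'rV[R]_3)
    (phi : 'rV[R]_2 -> 'rV[R]_3) : Prop :=
  [/\ open U, open V & phi @` U = S `&` V] /\
  [/\ smooth U phi,
      forall u, U u -> injective ('d phi u) &
      exists2 psi : 'rV[R]_3 -> 'rV[R]_2,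
        forall u, U u -> psi (phi u) = u & {within S `&` V, continuous psi}].

Definition embedded_surface S : Prop :=
  forall p, S p -> exists U V phi, V p /\ local_parametrization S U V phi.

Definition closed_embedded_surface S : Prop :=
  [/\ embedded_surface S, compact S, connected S & S !=set0].

Definition tangent S p : set 'rV[R]_3 :=
  [set v | exists (eps : R) (gamma : R^o -> 'rV[R]_3),
    [/\ 0 < eps, smooth (ball (0 : R^o) eps) gamma,
        forall t, ball (0 : R^o) eps t -> S (gamma t),
        gamma 0 = p & 'D_1 gamma 0 = v]].

(* Vector fields along S are total functions of which only the values on S
   matter; they are differentiated through smooth local extensions to R^3. *)
Definition local_extension S X p (Y : 'rV[R]_3 -> 'rV[R]_3) : Prop :=
  exists V : set 'rV[R]_3,
    [/\ open V, V p, smooth V Y & forall q, S q -> V q -> Y q = X q].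

Definition smooth_near S X p : Prop := exists Y, local_extension S X p Y.

(* The Euclidean derivative nabla_v X at p of a field X along S.  For v tangent
   to S at p and X smooth near p, the value 'D_v Y p is the same for all local
   extensions Y, so the choice is immaterial. *)
Definition nabla S v X p : 'rV[R]_3 :=
  xget 0 [set w | exists2 Y, local_extension S X p Y & w = 'D_v Y p].

Definition orthonormal_frame S p (e : 'I_2 -> 'rV[R]_3 -> 'rV[R]_3) : Prop :=
  (forall i, smooth_near S (e i) p) /\
  (\forall q \near p, S q ->
     (forall i, tangent S q (e i q)) /\
     (forall i j, dot (e i q) (e j q) = (i == j)%:R)).

(* The points lying in bounded connected components of the complement of S. *)
Definition enclosed S : set 'rV[R]_3 :=
  [set q | ~ S q /\ bounded_set (connected_component (~` S) q)].

Definition outward_unit_normal S (n : 'rV[R]_3 -> 'rV[R]_3) : Prop :=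
  forall p, S p ->
    [/\ smooth_near S n p,
        dot (n p) (n p) = 1,
        forall v, tangent S p v -> dot (n p) v = 0,
        \forall t \near (0 : R)^'+, enclosed S (p - t *: n p) &
        \forall t \near (0 : R)^'+, ~ (S `|` enclosed S) (p + t *: n p)].

Definition surface_div S (e : 'I_2 -> 'rV[R]_3 -> 'rV[R]_3) X p : R :=
  \sum_(i < 2) dot (nabla S (e i p) X p) (e i p).

Definition second_form_coef S (n : 'rV[R]_3 -> 'rV[R]_3)
    (e : 'I_2 -> 'rV[R]_3 -> 'rV[R]_3) p (i j : 'I_2) : R :=
  dot (nabla S (e i p) (e j) p) (n p).

(* The next two relations state that h is the value at p of H = div_S n, and
   that a is the value at p of |A|; neither depends on the frame. *)
Definition is_mean_curvature S (n : 'rV[R]_3 -> 'rV[R]_3) p (h : R) : Prop :=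
  exists2 e, orthonormal_frame S p e & h = surface_div S e n p.

Definition is_second_form_length S (n : 'rV[R]_3 -> 'rV[R]_3) p (a : R) : Prop :=
  exists2 e, orthonormal_frame S p e &
    a = Num.sqrt (\sum_(i < 2) \sum_(j < 2) second_form_coef S n e p i j ^+ 2).

Definition lambda_hypersurface S (n : 'rV[R]_3 -> 'rV[R]_3) (lambda : R) : Prop :=
  forall p, S p ->
    exists2 h, is_mean_curvature S n p h & h - dot p (n p) / 2 = lambda.

Definition round_sphere S : Prop :=
  exists (c : 'rV[R]_3) (r : R), 0 < r /\ S = [set x | dot (x - c) (x - c) = r ^+ 2].

End Surfaces.

(* Main.v *)
Require Import Defs.
From mathcomp Require Import all_boot all_order all_algebra ring lra.
From mathcomp Require Import all_classical all_reals all_analysis.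

Set Implicit Arguments.
Unset Strict Implicit.
Unset Printing Implicit Defensive.

Import Order.TTheory GRing.Theory Num.Theory.
Import numFieldTopology.Exports numFieldNormedType.Exports.

Local Open Scope classical_set_scope.
Local Open Scope ring_scope.

(** Write n for the outward normal, B for its differential on tangent planes,
    H = tr B, c = |A|^2 = tr (B^2), and g(h) = h (3 c - h^2) / 2.  In dimension
    two the symmetric form B satisfies tr (B^3) = g(H) and H^2 <= 2 c, with
    H^2 = 2 c exactly at the umbilic points.

    Local identities.  Gauss, Codazzi and the equation
    H = lambda + <x, n> / 2 give Simons' identity; contracted with B, whose
    length is constant, it reads

      |nabla B|^2 = c^2 - c / 2 - lambda g(H)                            (1)

    ([second_form_jet]).  Hence the gradient of H is bounded by a function of
    H alone ([gradient_bound]).  At a critical point of H that is not umbilic,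
    the Codazzi equations and the constancy of tr (B^2) leave no room for
    nabla B, so the right-hand side of (1) vanishes there
    ([frame_critical_nonumbilic]); and at any critical point of H its
    Laplacian is (1/2 - c) H + c lambda ([frame_critical_laplacian]).

    Global argument.  At a point p of S farthest from the origin, the outward
    normal is p / |p| ([farthest_normal]), so H(p) = lambda + |p| / 2 is the
    maximum of H.  If H is constant then <x, n> = |p| everywhere and S lies on
    the sphere of radius |p|; it fills this sphere, because otherwise the
    complement of S would have no bounded component ([sphere_filled]).  So it
    is enough to show that H is constant.  Let z be a minimum point of H.

    If z is umbilic, then H(z) = sqrt (2 c), and H is constant, or
    H(z) = - sqrt (2 c).  Comparing the latter with H(p) <= sqrt (2 c) and
    <z, n> >= - |p| gives <z, n> = - |p|, so that z is another farthest point,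
    at which n points inwards: a contradiction.

    If z is not umbilic ([support_mean_constant]) and lambda = 0, then (1) at
    z gives c = 1/2, and (1) everywhere gives nabla B = 0.  If lambda > 0, the
    signs of the Laplacian at z and at p, combined with (1) at these points,
    give 0 < H(z) <= sqrt c <= H(p).  As S is connected, H takes the value
    sqrt c, at which g is largest; comparing (1) there and at z yields
    lambda g(sqrt c) = c^2 - c / 2, and (1) becomes

      |nabla B|^2 = lambda (H - sqrt c)^2 (H + 2 sqrt c) / 2.

    By Gronwall's inequality along curves of S the set where H = sqrt c is
    open in S ([constant_of_gradient_bound]), so H is constant.

    Cylinders satisfy the equation and have |A| constant, so the local
    identities alone cannot suffice: compactness enters through p and z.

    The local computations take place in the ambient space.  A function on S
    near a point is represented by a smooth function on an open subset V of
    R^3, and equations are required on S only.  Differentiation along a field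
    that is tangent to S respects these equations ([derive_tangent]), so an
    orthonormal frame E1, E2 of S acts by two derivations, whose commutator is
    computed from the symmetry of B ([adapted_surface_frame]).  Charts are used
    for that symmetry and for Gronwall's inequality. *)

(** * Inner products and orthonormal bases of R^3 *)

Section Dot.
Variable R : realType.
Implicit Types u v w : 'rV[R]_3.

Lemma dotC n (u v : 'rV[R]_n) : dot u v = dot v u.
Proof. by apply: eq_bigr => i _; rewrite mulrC. Qed.

Lemma dotDl n (u v w : 'rV[R]_n) : dot (u + v) w = dot u w + dot v w.
Proof. by rewrite /dot -big_split; apply: eq_bigr => i _; rewrite mxE mulrDl. Qed.

Lemma dotZl n k (u w : 'rV[R]_n) : dot (k *: u) w = k * dot u w.
Proof. by rewrite /dot mulr_sumr; apply: eq_bigr => i _; rewrite mxE mulrA. Qed.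

Lemma dotDr n (u v w : 'rV[R]_n) : dot w (u + v) = dot w u + dot w v.
Proof. by rewrite !(dotC w) dotDl. Qed.

Lemma dotZr n k (u w : 'rV[R]_n) : dot w (k *: u) = k * dot w u.
Proof. by rewrite !(dotC w) dotZl. Qed.

Lemma dot0l n (w : 'rV[R]_n) : dot 0 w = 0.
Proof. by rewrite -(scale0r 0) dotZl mul0r. Qed.

Lemma dotNl n (u w : 'rV[R]_n) : dot (- u) w = - dot u w.
Proof. by rewrite -scaleN1r dotZl mulN1r. Qed.

Lemma dotNr n (u w : 'rV[R]_n) : dot w (- u) = - dot w u.
Proof. by rewrite !(dotC w) dotNl. Qed.

Definition orthonormal3 u v w :=
  [/\ dot u u = 1, dot v v = 1 & dot w w = 1] /\
  [/\ dot u v = 0, dot u w = 0 & dot v w = 0].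

(** The index 2 of 'I_3 is written [inord 2] because the literal 2 in this
    ring type means 1 + 1. *)
Lemma sum3E (V : nmodType) (F : 'I_3 -> V) : \sum_(k < 3) F k = F 0 + F 1 + F (inord 2).
Proof.
rewrite !big_ord_recl big_ord0 addr0 addrA; congr (F _ + F _ + F _); apply/val_inj => //=.
by rewrite inordK.
Qed.

Lemma sum2E (V : nmodType) (F : 'I_2 -> V) : \sum_(k < 2) F k = F 0 + F 1.
Proof.
by rewrite !big_ord_recl big_ord0 addr0; congr (_ + F _); apply/val_inj.
Qed.

(** The matrix O with rows e1, e2, e3 satisfies O O^T = 1, hence O^T O = 1. *)
Lemma orthonormal3_expand e1 e2 e3 v : orthonormal3 e1 e2 e3 ->
  v = dot v e1 *: e1 + dot v e2 *: e2 + dot v e3 *: e3.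
Proof.
move=> [] [d11 d22 d33] [d12 d13 d23].
pose O : 'M[R]_3 := \matrix_(i < 3) [:: e1; e2; e3]`_i.
have rO i : row i O = [:: e1; e2; e3]`_i by rewrite rowK.
have OO : O *m O^T = 1%:M.
  apply/matrixP => i j.
  have -> : (O *m O^T) i j = dot (row i O) (row j O).
    by rewrite mxE; apply: eq_bigr => k _; rewrite !mxE.
  rewrite !rO !mxE.
  by case: i => [] [|[|[|i]]] Hi //; case: j => [] [|[|[|j]]] Hj //=;
    rewrite ?d11 ?d22 ?d33 ?d12 ?d13 ?d23 // dotC ?d12 ?d13 ?d23.
have {}OO := mulmx1C OO.
rewrite -[LHS]mulmx1 -OO mulmxA mulmx_sum_row sum3E !rO /= inordK //=.
by congr (_ *: _ + _ *: _ + _ *: _); rewrite mxE; apply: eq_bigr => k _; rewrite !mxE ?inordK.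
Qed.

Lemma orthonormal3_dot e1 e2 e3 u v : orthonormal3 e1 e2 e3 ->
  dot u v = dot u e1 * dot v e1 + dot u e2 * dot v e2 + dot u e3 * dot v e3.
Proof.
by move=> /(orthonormal3_expand u) {1}->; rewrite !dotDl !dotZl !(dotC _ v).
Qed.
End Dot.

(** * Rules for smooth functions *)

Section Smooth.
Context {R : realType} {V W : normedModType R}.
Implicit Types (U : set V) (f g : V -> W).

(** Both conditions defining a differential, continuity and the first-order
    expansion, see the function only near x. *)
Lemma near_eq_differentiable f g (x : V) : (\forall z \near x, f z = g z) ->
  differentiable f x -> differentiable g x.
Proof.
move=> fg /diff_locallyP[cdf /eqaddoP lf].
have fgx : f x = g x by exact: (nbhs_singleton fg).
have sfg : \forall z \near (0 : V), (f \o shift x) z = (g \o shift x) z.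
  have /= : \forall z \near (0 : V), f (z + x) = g (z + x).
    rewrite (near_shift x) /=; apply: filterS fg => z.
    by rewrite /= sub0r subrK.
  by [].
have lg : g \o shift x = cst (g x) + 'd f x +o_ 0 id.
  apply/eqaddoP => e e0; have := lf e e0; move: sfg; apply: filterS2 => z /= sfz.
  by rewrite !fctE /= sfz fgx.
by apply/diff_locallyP; rewrite (diff_unique cdf lg).
Qed.

Lemma Ck_ext k U f g : open U -> (forall x, U x -> f x = g x) ->
  Ck k U f -> Ck k U g.
Proof.
move=> oU; elim: k f g => [|k IH] f g fg /=.
  move=> cf x Ux; have cfx : f @ x --> f x := cf x Ux.
  change (g @ x --> g x); rewrite -(fg x Ux); apply: cvg_trans cfx.
  by apply: near_eq_cvg; near=> z; apply: fg; near: z; exact: open_nbhs_nbhs.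
have nfg x : U x -> \near x, f x = g x.
  by move=> Ux; near=> z; apply: fg; near: z; exact: open_nbhs_nbhs.
move=> [df Cf]; split=> [x Ux|v].
  exact: near_eq_differentiable (nfg x Ux) (df x Ux).
apply: IH (Cf v) => x Ux; exact: near_eq_derive (nfg x Ux).
Unshelve. all: by end_near. Qed.

Lemma Ck_subset k U U' f : U' `<=` U -> Ck k U f -> Ck k U' f.
Proof.
move=> sU; elim: k f => [|k IH] f /=; first by move=> cf x /sU/cf.
by move=> [df Cf]; split=> [x /sU/df//|v]; exact: IH.
Qed.

Lemma CkD k U f g : open U -> Ck k U f -> Ck k U g -> Ck k U (fun x => f x + g x).
Proof.
move=> oU; elim: k f g => [|k IH] f g /=.
  by move=> cf cg x Ux; apply: continuousD; [exact: cf|exact: cg].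
move=> [df Cf] [dg Cg]; split=> [x Ux|v].
  by apply: differentiableD; [exact: df|exact: dg].
apply: (@Ck_ext k U (fun x => 'D_v f x + 'D_v g x)) => //; last exact: IH.
by move=> x Ux; rewrite deriveD//; apply: diff_derivable; [exact: df|exact: dg].
Qed.

End Smooth.

Section SmoothRules.
Context {R : realType} {V : normedModType R}.
Implicit Types (U : set V).

Lemma smooth_ext (W : normedModType R) U (f g : V -> W) : open U ->
  (forall x, U x -> f x = g x) -> smooth U f -> smooth U g.
Proof. by move=> oU fg sf k; exact: Ck_ext (sf k). Qed.

Lemma smooth_subset (W : normedModType R) U U' (f : V -> W) : U' `<=` U ->
  smooth U f -> smooth U' f.
Proof. by move=> sU sf k; exact: Ck_subset (sf k). Qed.

Lemma smooth_differentiable (W : normedModType R) U (f : V -> W) x :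
  smooth U f -> U x -> differentiable f x.
Proof. by move=> /(_ 1)[df _]; exact: df. Qed.

Lemma smooth_derivable (W : normedModType R) U (f : V -> W) x v :
  smooth U f -> U x -> derivable f x v.
Proof. by move=> sf Ux; apply/diff_derivable/(smooth_differentiable sf). Qed.

Lemma smooth_derive (W : normedModType R) U (f : V -> W) v :
  smooth U f -> smooth U (fun x => 'D_v f x).
Proof. by move=> sf k; have [_] := sf k.+1; exact. Qed.

Lemma smooth_cst (W : normedModType R) U (w : W) : smooth U (fun=> w).
Proof.
move=> k; elim: k w => [|k IH] w /=; first by move=> x _; exact: cvg_cst.
split=> [x _|v]; first exact: differentiable_cst.
have -> : (fun x : V => 'D_v (fun=> w) x) = fun=> 0.
  by apply/funext => x; exact: (derive_cst w x v).
exact: IH.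
Qed.

Lemma smoothD (W : normedModType R) U (f g : V -> W) : open U ->
  smooth U f -> smooth U g -> smooth U (fun x => f x + g x).
Proof. by move=> oU sf sg k; exact: CkD. Qed.

(** The induction on the order of differentiability needs smooth factors: the
    Leibniz rule involves the factors as well as their derivatives. *)
Lemma smoothM U (f g : V -> R) : open U ->
  smooth U f -> smooth U g -> smooth U (fun x => f x * g x).
Proof.
move=> oU sf sg k; elim: k f g sf sg => [|k IH] f g sf sg /=.
  move=> x Ux; apply: continuousM; exact: (sf 0 x Ux) || exact: (sg 0 x Ux).
split=> [x Ux|v].
  by apply: differentiableM; [exact: smooth_differentiable sf _|exact: smooth_differentiable sg _].
apply: (@Ck_ext _ _ _ k U (fun x => f x * 'D_v g x + g x * 'D_v f x)) => //.
  move=> x Ux; rewrite deriveM//; first exact: smooth_derivable sf _.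
  exact: smooth_derivable sg _.
by apply: CkD => //; apply: IH => //; exact: smooth_derive.
Qed.

Lemma derive_coord m n (f : V -> 'M[R]_(m, n)) x v i j : derivable f x v ->
  'D_v (fun x => f x i j) x = 'D_v f x i j.
Proof. by move=> df; rewrite derive_mx// mxE. Qed.

Lemma smooth_coord m n U (f : V -> 'M[R]_(m, n)) i j : open U ->
  smooth U f -> smooth U (fun x => f x i j).
Proof.
move=> oU sf k; elim: k f sf => [|k IH] f sf /=.
  move=> x Ux; apply: (@continuous_comp _ _ _ f (fun M => M i j) x).
    exact: (sf 0 x Ux).
  exact: coord_continuous.
split=> [x Ux|v].
  apply: (@differentiable_comp _ _ _ _ f (fun M => M i j)).
    exact: smooth_differentiable sf _.
  exact: differentiable_coord.
apply: (@Ck_ext _ _ _ k U (fun x => 'D_v f x i j)) => //.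
  by move=> x Ux; rewrite derive_coord//; exact: smooth_derivable sf _.
by apply: IH; exact: smooth_derive.
Qed.

Lemma smooth_id U : open U -> smooth U (id : V -> V).
Proof.
move=> oU [|k] /=; first by move=> x _; exact: cvg_id.
split=> [x _|v]; first exact: ex_diff.
apply: (@Ck_ext _ _ _ k U (fun=> v)) => //; last exact: smooth_cst.
by move=> x Ux; rewrite derive_id.
Qed.

End SmoothRules.

Section SmoothDirectional.
Context {R : realType} {n : nat}.
Notation T := 'rV[R]_n.

(** The passage from a variable direction to constant ones: differentiation
    along a field becomes a combination of partial derivatives. *)
Lemma derive_rowE (F : T -> R) x v : differentiable F x ->
  'D_v F x = \sum_(k < n) v 0 k * 'D_(delta_mx 0 k) F x.
Proof.
move=> dF; rewrite deriveE// {1}(row_sum_delta v) linear_sum.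
by apply: eq_bigr => k _; rewrite linearZ deriveE.
Qed.

Lemma smooth_derive_field (U : set T) (F : T -> R) (Y : T -> T) : open U ->
  smooth U F -> smooth U Y -> smooth U (fun x => 'D_(Y x) F x).
Proof.
move=> oU sF sY.
apply: (@smooth_ext _ _ _ _ (fun x => \sum_(k < n) Y x 0 k * 'D_(delta_mx 0 k) F x)) => //.
  by move=> x Ux; rewrite [RHS]derive_rowE//; exact: smooth_differentiable sF _.
elim: (index_enum _) => [|i r IH].
  apply: (@smooth_ext _ _ _ _ (fun=> 0)) => //; last exact: smooth_cst.
  by move=> x _; rewrite big_nil.
apply: (@smooth_ext _ _ _ _ (fun x => Y x 0 i * 'D_(delta_mx 0 i) F x +
  \sum_(k <- r) Y x 0 k * 'D_(delta_mx 0 k) F x)) => //.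
  by move=> x _; rewrite big_cons.
apply: smoothD => //; apply: smoothM => //; first exact: smooth_coord.
exact: smooth_derive.
Qed.

End SmoothDirectional.

(** * Chain rule and symmetry of second derivatives *)

Section Chain.
Context {R : realType}.

Lemma derive_comp (U V W : normedModType R) (f : V -> W) (g : U -> V) u v :
  differentiable g u -> differentiable f (g u) ->
  'D_v (f \o g) u = 'D_('D_v g u) f (g u).
Proof.
move=> dg df; have dfg := differentiable_comp dg df.
by rewrite (deriveE _ dfg) (deriveE _ df) (deriveE _ dg) diff_comp.
Qed.

Lemma is_derive_line (V W : normedModType R) (f : V -> W) (y v : V) (t : R) :
  differentiable f (y + t *: v) ->
  is_derive t 1 (fun s => f (y + s *: v)) ('D_v f (y + t *: v)).
Proof.
move=> df; pose g (s : R) := y + s *: v.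
have dg : is_diff t g (fun s => s *: v).
  have -> : (fun s : R => s *: v) = (fun=> 0) + (fun s => s *: v).
    by apply/funext => s; rewrite fctE add0r.
  exact: is_diffD.
have dfg : differentiable (f \o g) t by apply: differentiable_comp => //; exact: ex_diff.
apply: DeriveDef; first exact: diff_derivable.
have dgt : differentiable g t by exact: ex_diff.
have gv : 'd g t 1 = v by rewrite diff_val scale1r.
by have := @derive_comp _ _ _ f g t 1 dgt df; rewrite (deriveE _ dgt) gv.
Qed.

Lemma mean_value_is_derive (g dg : R -> R) (h : R) : 0 < h ->
  (forall t, 0 <= t <= h -> is_derive t 1 g (dg t)) ->
  exists2 t, 0 <= t <= h & g h - g 0 = dg t * h.
Proof.
move=> h0 der.
have [||t th e] := @MVT R g dg 0 h h0.
- by move=> t; rewrite in_itv /= => /andP[t0 t1]; apply: der; rewrite !ltW.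
- apply: derivable_within_continuous => t; rewrite in_itv /= => th.
  exact: (ex_derive (is_derive := der _ th)).
- exists t; first by move: th; rewrite in_itv /= => /andP[? ?]; rewrite !ltW.
  by rewrite e subr0.
Qed.

(** Two applications of the mean value theorem to a second difference that is
    symmetric in v and w; exchanging v and w gives the other mixed derivative. *)
Lemma second_difference (V : normedModType R) (f : V -> R) (x v w : V) (h r : R) :
  smooth (ball x r) f -> 0 < h -> h * (`|v| + `|w|) < r ->
  exists s t, [/\ 0 <= s <= h, 0 <= t <= h &
    f (x + h *: v + h *: w) - f (x + h *: v) - (f (x + h *: w) - f x)
    = 'D_w (fun y => 'D_v f y) (x + s *: v + t *: w) * h * h].
Proof.
move=> sf h0 hr.
have inb s t : 0 <= s <= h -> 0 <= t <= h -> ball x r (x + s *: v + t *: w).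
  move=> /andP[s0 sh] /andP[t0 th]; rewrite -ball_normE /ball_ /=.
  rewrite -addrA opprD addNKr normrN (le_lt_trans (ler_normD _ _))//.
  rewrite !normrZ !ger0_norm//; apply: le_lt_trans hr; rewrite mulrDr.
  by rewrite lerD// ler_wpM2r.
have h00 : (0 : R) <= 0 <= h by rewrite lexx ltW.
have hh : 0 <= h <= h by rewrite lexx ltW.
have [|s sh e] := @mean_value_is_derive
  (fun s => f (x + h *: w + s *: v) - f (x + s *: v))
  (fun s => 'D_v f (x + h *: w + s *: v) - 'D_v f (x + s *: v)) h h0.
  move=> s sh; apply: is_deriveB; apply: is_derive_line;
    apply: (smooth_differentiable sf).
    by rewrite addrAC; exact: inb.
  by have := inb s 0 sh h00; rewrite scale0r addr0.
have [|t th e'] := @mean_value_is_derive (fun t => 'D_v f (x + s *: v + t *: w))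
  (fun t => 'D_w (fun y => 'D_v f y) (x + s *: v + t *: w)) h h0.
  move=> t th; apply: is_derive_line.
  by apply: (smooth_differentiable (smooth_derive v sf)); exact: inb.
exists s, t; split => //.
move: e e'; rewrite !scale0r !addr0 => e e'; rewrite -e'.
by rewrite [x + s *: v + h *: w]addrAC -e [x + h *: w + h *: v]addrAC.
Qed.

(** The second difference is both mixed derivatives, at two points tending to x,
    and both are continuous at x. *)
Lemma derive_commute (V : normedModType R) (U : set V) (f : V -> R) (x v w : V) :
  open U -> U x -> smooth U f ->
  'D_v (fun y => 'D_w f y) x = 'D_w (fun y => 'D_v f y) x.
Proof.
move=> oU Ux sf.
have [r /= r0 rU] : exists2 r : R, 0 < r & ball x r `<=` U.
  by have /nbhs_ballP[r r0 rU] := open_nbhs_nbhs (conj oU Ux); exists r.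
pose A := fun y => 'D_v (fun y => 'D_w f y) y.
pose B := fun y => 'D_w (fun y => 'D_v f y) y.
have cA : {for x, continuous A} by exact: (smooth_derive v (smooth_derive w sf) 0).
have cB : {for x, continuous B} by exact: (smooth_derive w (smooth_derive v sf) 0).
change (A x = B x).
apply/eqP; rewrite -subr_eq0 -normr_eq0 eq_le normr_ge0 andbT.
apply/ler_addgt0Pl => e e0; rewrite addr0.
have e2 : 0 < e / 2 by rewrite divr_gt0.
have /cvgrPdist_lt /(_ _ e2) /nbhs_ballP[r1 /= r10 h1] := cA.
have /cvgrPdist_lt /(_ _ e2) /nbhs_ballP[r2 /= r20 h2] := cB.
pose m := Num.min r (Num.min r1 r2).
have m0 : 0 < m by rewrite !lt_min r0 r10.
pose h := m / (`|v| + `|w| + 1).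
have vw0 : 0 < `|v| + `|w| + 1 by rewrite ltr_wpDl// addr_ge0.
have h0 : 0 < h by rewrite divr_gt0.
have hm : h * (`|v| + `|w|) < m.
  by rewrite /h mulrAC ltr_pdivrMr// ltr_pM2l// ltrDl.
have sb : smooth (ball x r) f := smooth_subset rU sf.
have hr : h * (`|v| + `|w|) < r by apply: lt_le_trans hm _; rewrite ge_min lexx.
have hr' : h * (`|w| + `|v|) < r by rewrite addrC.
have [s [t [sh th eB]]] := second_difference sb h0 hr.
have [s' [t' [sh' th' eA]]] := second_difference sb h0 hr'.
have inb z u s0 t0 : 0 <= s0 <= h -> 0 <= t0 <= h -> `|z| + `|u| = `|v| + `|w| ->
    ball x m (x + s0 *: z + t0 *: u).
  move=> /andP[s00 sh0] /andP[t00 th0] zu; rewrite -ball_normE /ball_ /=.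
  rewrite -addrA opprD addNKr normrN (le_lt_trans (ler_normD _ _))//.
  rewrite !normrZ !ger0_norm//; apply: le_lt_trans hm; rewrite -zu mulrDr.
  by rewrite lerD// ler_wpM2r.
have b1 := inb w v s' t' sh' th' (addrC _ _).
have b2 := inb v w s t sh th erefl.
have {}eA : f (x + h *: w + h *: v) - f (x + h *: w) - (f (x + h *: v) - f x) =
  A (x + s' *: w + t' *: v) * h * h by exact: eA.
have {}eB : f (x + h *: v + h *: w) - f (x + h *: v) - (f (x + h *: w) - f x) =
  B (x + s *: v + t *: w) * h * h by exact: eB.
clearbody A B.
have AB : A (x + s' *: w + t' *: v) = B (x + s *: v + t *: w).
  have hn : h != 0 by rewrite gt_eqF.
  have swap (X P Q F : R) : X - P - (Q - F) = X - Q - (P - F) by ring.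
  apply: (mulIf hn); apply: (mulIf hn); rewrite -eA -eB [x + h *: w + h *: v]addrAC.
  exact: swap.
have a1 : `|A x - A (x + s' *: w + t' *: v)| < e / 2.
  by apply/h1/(le_ball _ b1); rewrite /m !ge_min lexx orbT.
have a2 : `|B x - B (x + s *: v + t *: w)| < e / 2.
  by apply/h2/(le_ball _ b2); rewrite /m !ge_min lexx !orbT.
rewrite AB in a1.
rewrite -(subrKA (B (x + s *: v + t *: w))) (le_trans (ler_normD _ _))//.
by rewrite [leRHS]splitr ltW// ltrD// distrC.
Qed.
End Chain.

(** * Tangent vectors of a subset of R^3 *)

Section Tangent.
Context {R : realType}.
Notation T := 'rV[R]_3.
Implicit Types (S : set T) (p q v : T).

Lemma open_ball_subset (V : normedModType R) (U : set V) (x : V) : open U -> U x ->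
  exists2 r : R, 0 < r & ball x r `<=` U.
Proof.
by move=> oU Ux; have /nbhs_ballP[r /= r0 rU] := open_nbhs_nbhs (conj oU Ux); exists r.
Qed.

Lemma differentiable_line (V : normedModType R) (y v : V) (t : R) :
  differentiable (fun s : R => y + s *: v) t.
Proof.
have -> : (fun s : R => y + s *: v) = cst y + (fun s => s *: v) by [].
apply: differentiableD; first exact: differentiable_cst.
exact: ex_diff.
Qed.

Lemma derive_line (V W : normedModType R) (f : V -> W) (y v : V) (t c : R) :
  differentiable f (y + t *: v) ->
  'D_(c : R^o) (fun s : R^o => f (y + s *: v)) t = 'D_(c *: v) f (y + t *: v).
Proof.
move=> df.
have dl := differentiable_line y v t.
have dg : 'D_(c : R^o) (fun s : R^o => y + s *: v) t = c *: v.
  have -> : (fun s : R => y + s *: v) = cst y + (fun s => s *: v) by [].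
  rewrite deriveD; first last.
  - by apply: diff_derivable; exact: ex_diff.
  - exact: derivable_cst.
  by rewrite derive_cst add0r deriveE// diff_val.
by rewrite -dg -(derive_comp c dl df).
Qed.

Lemma smooth_line (V W : normedModType R) (U : set V) (f : V -> W) (y v : V) (I : set R^o) :
  open I -> (forall t, I t -> U (y + t *: v)) -> smooth U f ->
  smooth I (fun t : R^o => f (y + t *: v)).
Proof.
move=> oI IU sf k; elim: k f sf => [|k IH] f sf /=.
  move=> t It; apply: (@continuous_comp R^o V W (fun t : R^o => y + t *: v) f t).
    exact/differentiable_continuous/differentiable_line.
  exact: (sf 0 _ (IU t It)).
have df t : I t -> differentiable f (y + t *: v).
  by move=> It; apply: smooth_differentiable sf (IU t It).
split=> [t It|c].
  by apply: (@differentiable_comp _ R^o V W (fun t : R^o => y + t *: v) f);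
    [exact: differentiable_line|exact: df].
apply: (@Ck_ext _ _ _ k I (fun t : R^o => 'D_(c *: v) f (y + t *: v))) => //.
  by move=> t It; rewrite [RHS](derive_line c (df t It)).
by apply: (IH (fun z => 'D_(c *: v) f z)); exact: smooth_derive.
Qed.

(** The curves t |-> f (y + t v) serve both for charts, where V is the plane, and
    for shifted curves, where V is the line. *)
Lemma smooth_image_tangent (V : normedModType R) (U : set V) (f : V -> T) S (y v : V) :
  open U -> smooth U f -> (forall u, U u -> S (f u)) -> U y ->
  tangent S (f y) ('D_v f y).
Proof.
move=> oU sf fS Uy.
have [r r0 rU] := open_ball_subset oU Uy.
pose eps := r / (`|v| + 1).
have v0 : 0 < `|v| + 1 by rewrite ltr_wpDl.
have e0 : 0 < eps by rewrite divr_gt0.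
have inU (t : R^o) : ball (0 : R^o) eps t -> U (y + t *: v).
  rewrite -ball_normE /ball_ /= sub0r normrN => te; apply: rU.
  rewrite -ball_normE /ball_ /= opprD addNKr normrN normrZ.
  have : `|t| * (`|v| + 1) < r by rewrite -ltr_pdivlMr.
  by apply: le_lt_trans; rewrite ler_wpM2l// lerDl.
exists eps, (fun t : R^o => f (y + t *: v)); split => //.
- by apply: smooth_line inU sf; exact: ball_open.
- by move=> t /inU/fS.
- by rewrite scale0r addr0.
- rewrite (@derive_line _ _ f y v 0 1); first by rewrite scale1r scale0r addr0.
  by rewrite scale0r addr0; exact: smooth_differentiable sf Uy.
Qed.

(** A tangent vector is the velocity of a curve in S, along which F and G
    coincide.  This makes equations on S differentiable in tangent directions. *)
Lemma derive_tangent (W : normedModType R) S (V : set T) (F G : T -> W) q v :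
  open V -> V q -> (forall z, S z -> V z -> F z = G z) ->
  differentiable F q -> differentiable G q -> tangent S q v -> 'D_v F q = 'D_v G q.
Proof.
move=> oV Vq FG dF dG [eps [gam [e0 sg gS g0 gv]]].
have b0 : ball (0 : R^o) eps 0 by exact: ballxx.
have dg : differentiable gam 0 by exact: smooth_differentiable sg b0.
rewrite -gv -g0; rewrite -g0 in dF dG Vq.
rewrite -(@derive_comp _ R^o _ _ F gam 0 1 dg dF) -(@derive_comp _ R^o _ _ G gam 0 1 dg dG).
apply: near_eq_derive.
have n1 : \forall t \near (0 : R^o), ball (0 : R^o) eps t by exact: nbhsx_ballx.
have n2 : \forall t \near (0 : R^o), V (gam t).
  have cg := differentiable_continuous dg.
  by apply: cg; exact: open_nbhs_nbhs.
near=> t; apply: FG.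
- by apply: gS; near: t.
- by near: t.
Unshelve. all: by end_near. Qed.

(** The choice of an extension in [nabla] is immaterial for tangent directions. *)
Lemma nablaE S (X Y : T -> T) q v : tangent S q v -> local_extension S X q Y ->
  nabla S v X q = 'D_v Y q.
Proof.
move=> tv exY.
have /xgetPex : exists w, (fun w => exists2 Y, local_extension S X q Y & w = 'D_v Y q) w.
  by exists ('D_v Y q), Y.
move=> /(_ 0) [Z [V' [oV' V'q sZ ZX]] eZ].
have {}eZ : nabla S v X q = 'D_v Z q by exact: eZ.
rewrite eZ.
have [V [oV Vq sY YX]] := exY.
apply: (@derive_tangent _ S (V `&` V')) => //.
- exact: openI.
- by move=> z Sz [Vz V'z]; rewrite ZX// YX.
- exact: smooth_differentiable sZ V'q.
- exact: smooth_differentiable sY Vq.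
Qed.

End Tangent.

(** * Symmetry of the second fundamental form *)

Section Shape.
Context {R : realType}.
Notation T := 'rV[R]_3.
Implicit Types (S : set T) (p q : T).

Lemma derive_dot (V : normedModType R) n (X Y : V -> 'rV[R]_n) x v :
  derivable X x v -> derivable Y x v ->
  'D_v (fun z => dot (X z) (Y z)) x = dot ('D_v X x) (Y x) + dot (X x) ('D_v Y x).
Proof.
move=> dX dY.
have dc (Z : V -> 'rV[R]_n) i : derivable Z x v -> derivable (fun z => Z z 0 i) x v.
  by move=> /derivable_mxP.
have -> : (fun z => dot (X z) (Y z)) = \sum_(i < n) ((fun z => X z 0 i) * (fun z => Y z 0 i)).
  by apply/funext => z; rewrite fct_sumE.
rewrite derive_sum; last by move=> i; apply: derivableM; exact: dc.
rewrite -big_split; apply: eq_bigr => i _ /=.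
rewrite (deriveM (dc X i dX) (dc Y i dY)) (derive_coord _ _ dX) (derive_coord _ _ dY).
by rewrite addrC; congr (_ + _); exact: mulrC.
Qed.

Lemma derivable_dot (V : normedModType R) n (X Y : V -> 'rV[R]_n) x v :
  derivable X x v -> derivable Y x v -> derivable (fun z => dot (X z) (Y z)) x v.
Proof.
move=> dX dY.
have dc (Z : V -> 'rV[R]_n) i : derivable Z x v -> derivable (fun z => Z z 0 i) x v.
  by move=> /derivable_mxP.
have -> : (fun z => dot (X z) (Y z)) = \sum_(i < n) ((fun z => X z 0 i) * (fun z => Y z 0 i)).
  by apply/funext => z; rewrite fct_sumE.
by apply: derivable_sum => i; apply: derivableM; exact: dc.
Qed.

Lemma derive_commute_row (V : normedModType R) n (U : set V) (f : V -> 'rV[R]_n) (x v w : V) :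
  open U -> U x -> smooth U f ->
  'D_v (fun y => 'D_w f y) x = 'D_w (fun y => 'D_v f y) x.
Proof.
move=> oU Ux sf; apply/rowP => i.
have coord u u' : 'D_u (fun y => 'D_u' f y) x 0 i =
    'D_u (fun y => 'D_u' (fun z => f z 0 i) y) x.
  rewrite -derive_coord; last exact: (smooth_derivable (smooth_derive _ sf)).
  have [r r0 rU] := open_ball_subset oU Ux.
  apply: near_eq_derive; near=> z; rewrite derive_coord//.
  apply: (smooth_derivable sf); apply: rU; near: z; exact: nbhsx_ballx.
have sfi : smooth U (fun z => f z 0 i) by exact: smooth_coord.
apply: (etrans (coord v w)); apply: esym; apply: (etrans (coord w v)); apply: esym.
exact: (derive_commute v w oU Ux sfi).
Unshelve. all: by end_near. Qed.

Definition normal_along S (V : set T) (N : T -> T) :=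
  forall q, S q -> V q -> forall v, tangent S q v -> dot (N q) v = 0.

Lemma chart_derivative_tangent S U V phi u v : local_parametrization S U V phi ->
  U u -> tangent S (phi u) ('D_v phi u).
Proof.
move=> [[oU oV im] [sphi _ _]] Uu; apply: (smooth_image_tangent _ oU sphi) => // z Uz.
by have [] : (S `&` V) (phi z) by rewrite -im; exists z.
Qed.

(** Differentiating <N, d phi (t)> = 0 along s expresses the form as
    - <N, d^2 phi (s, t)>, which is symmetric. *)
Lemma chart_shape_symmetric S U V phi W N u s t : local_parametrization S U V phi ->
  open W -> smooth W N -> normal_along S W N -> U u -> W (phi u) ->
  dot ('D_('D_s phi u) N (phi u)) ('D_t phi u) = dot ('D_('D_t phi u) N (phi u)) ('D_s phi u).
Proof.
move=> chart oW sN nN Uu Wu.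
have [[oU oV im] [sphi _ _]] := chart.
have dphi z : U z -> differentiable phi z by move=> Uz; exact: smooth_differentiable sphi Uz.
have main s' t' : dot ('D_('D_s' phi u) N (phi u)) ('D_t' phi u) =
    - dot (N (phi u)) ('D_s' (fun z => 'D_t' phi z) u).
  have dN := smooth_differentiable sN Wu.
  have dNphi : derivable (N \o phi) u s'.
    by apply: diff_derivable; apply: differentiable_comp => //; exact: dphi.
  have dd : derivable (fun z => 'D_t' phi z) u s' by exact: smooth_derivable (smooth_derive _ sphi) Uu.
  have /eqP : 'D_s' (fun z => dot ((N \o phi) z) ('D_t' phi z)) u = 0.
    have cphi : {for u, continuous phi} by exact/differentiable_continuous/dphi.
    have n1 : \forall z \near u, W (phi z) by apply: cphi; exact: open_nbhs_nbhs.
    have n2 : \forall z \near u, U z by exact: open_nbhs_nbhs.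
    rewrite -[RHS](derive_cst 0 u s'); apply: near_eq_derive; near=> z.
    have Uz : U z by near: z.
    apply: nN; [|by near: z|exact: chart_derivative_tangent chart Uz].
    by have [] : (S `&` V) (phi z) by rewrite -im; exists z.
  rewrite derive_dot// (derive_comp _ (dphi _ Uu) dN) addr_eq0 => /eqP.
  exact.
apply: (etrans (main s t)); apply: esym; apply: (etrans (main t s)).
exact: (congr1 (fun x => - dot (N (phi u)) x) (derive_commute_row t s oU Uu sphi)).
Unshelve. all: by end_near. Qed.

(** If the determinant vanished, its rows would be linearly dependent: the
    explicit relations have coefficients (de, - be) and (ga, - al). *)
Lemma det_neq0_of_free (V : lmodType R) (e1 e2 f1 f2 : V) al be ga de :
  f1 = al *: e1 + be *: e2 -> f2 = ga *: e1 + de *: e2 ->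
  (forall a b, a *: f1 + b *: f2 = 0 -> a = 0 /\ b = 0) -> al * de - be * ga != 0.
Proof.
move=> E1 E2 comb; apply/negP => /eqP d0.
have lin a b : a *: f1 + b *: f2 = (a * al + b * ga) *: e1 + (a * be + b * de) *: e2.
  by rewrite E1 E2 !scalerDr !scalerA addrACA -!scalerDl.
have [de0 be0] : de = 0 /\ - be = 0.
  have e1E : de * al + - be * ga = al * de - be * ga by ring.
  have e2E : de * be + - be * de = 0 by ring.
  by apply: comb; rewrite lin e1E e2E d0 !scale0r addr0.
have [ga0 al0] : ga = 0 /\ - al = 0.
  have e1E : ga * al + - al * ga = 0 by ring.
  have e2E : ga * be + - al * de = - (al * de - be * ga) by ring.
  by apply: comb; rewrite lin e1E e2E d0 oppr0 !scale0r addr0.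
have [] : (1 : R) = 0 /\ (0 : R) = 0.
  apply: comb; rewrite lin ga0 de0 -[al]opprK al0 -[be]opprK be0.
  by rewrite oppr0 !mulr0 addr0 !scale0r addr0.
by move/eqP; rewrite oner_eq0.
Qed.

Lemma delta_mx2_free (a b : R) :
  a *: delta_mx 0 0 + b *: delta_mx 0 1 = 0 :> 'rV[R]_2 -> a = 0 /\ b = 0.
Proof.
move=> /rowP ab; split.
  by have := ab 0; rewrite !mxE /= mulr1 mulr0 addr0.
by have := ab 1; rewrite !mxE /= mulr1 mulr0 add0r.
Qed.

(** The partial derivatives f1, f2 of a chart lie in the span of e1, e2, and
    the defect of symmetry on (f1, f2) is that on (e1, e2) times the determinant
    of the change of basis, which is not zero. *)
Lemma shape_symmetric S V N p e1 e2 : embedded_surface S -> S p ->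
  open V -> V p -> smooth V N -> normal_along S V N ->
  orthonormal3 e1 e2 (N p) -> dot ('D_e1 N p) e2 = dot ('D_e2 N p) e1.
Proof.
move=> emb Sp oV Vp sN nN ortho.
have [U [W [phi [Wp chart]]]] := emb p Sp.
have [[oU oW im] [sphi inj _]] := chart.
have [u Uu up] : (phi @` U) p by rewrite im.
rewrite -up in Vp ortho *.
have Su : S (phi u) by rewrite up.
have dN := smooth_differentiable sN Vp.
pose f1 := 'D_(delta_mx 0 0) phi u; pose f2 := 'D_(delta_mx 0 1) phi u.
have sym : dot ('D_f1 N (phi u)) f2 = dot ('D_f2 N (phi u)) f1.
  exact: chart_shape_symmetric chart oV sN nN Uu Vp.
have exp v : v = f1 \/ v = f2 -> v = dot v e1 *: e1 + dot v e2 *: e2.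
  move=> v12; have vN : dot v (N (phi u)) = 0.
    rewrite dotC; apply: (nN _ Su Vp).
    by case: v12 => ->; exact: chart_derivative_tangent chart Uu.
  by rewrite [LHS](orthonormal3_expand v ortho) vN scale0r addr0.
have E1 := exp f1 (or_introl erefl); have E2 := exp f2 (or_intror erefl).
set al := dot f1 e1 in E1; set be := dot f1 e2 in E1.
set ga := dot f2 e1 in E2; set de := dot f2 e2 in E2.
have lin a b c d : dot ('D_(a *: e1 + b *: e2) N (phi u)) (c *: e1 + d *: e2) =
   a * c * dot ('D_e1 N (phi u)) e1 + a * d * dot ('D_e1 N (phi u)) e2 +
   b * c * dot ('D_e2 N (phi u)) e1 + b * d * dot ('D_e2 N (phi u)) e2.
  rewrite !(deriveE _ dN) linearD !linearZ !dotDl !dotDr !dotZl !dotZr.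
  move: (dot _ _) (dot _ _) (dot _ _) (dot _ _) => x y z w; ring.
have det0 : al * de - be * ga != 0.
  apply: (det_neq0_of_free E1 E2) => a b.
  have dphi : differentiable phi u by exact: smooth_differentiable sphi Uu.
  rewrite /f1 /f2 !(deriveE _ dphi) => ab; apply: delta_mx2_free.
  by apply: (inj u Uu); rewrite linearD !linearZ ab linear0.
clearbody al be ga de f1 f2.
subst f1 f2.
have cancel (x y z w : R) : al * ga * x + al * de * y + be * ga * z + be * de * w =
    ga * al * x + ga * be * y + de * al * z + de * be * w -> y = z.
  move=> e; apply: (mulfI det0); apply/eqP; rewrite -subr_eq0; apply/eqP.
  by move/eqP: e; rewrite -subr_eq0 => /eqP <-; ring.
exact: (cancel _ _ _ _ (etrans (esym (lin al be ga de)) (etrans sym (lin ga de al be)))).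
Qed.

End Shape.

(** * Surface equations in an orthonormal frame *)

(** Simons' identity at a point, with all derivatives as independent unknowns.
    Here ((a, b), (b, d)) is the matrix of B in the frame, w1 and w2 are the
    connection coefficients <D_i e1, e2>, and x1, x2, y are the components of the
    position along e1, e2 and n.  The letters A, B, E, W stand for derivatives of
    a, b, d, w: A1 is D1 a, A12 is D1 (D2 a), and W12 is D1 w2.  The left-hand side
    of the conclusion is |nabla B|^2. *)
Lemma simons_jet (R : realFieldType)
  (a b d w1 w2 x1 x2 y lam c A1 A2 B1 B2 E1 E2 W11 W12 W21 W22
   A11 A12 A21 A22 B11 B12 B21 B22 E11 E21 E22 : R) :
  a + d - y / 2 = lam -> a * a + 2 * (b * b) + d * d = c ->
  B1 - A2 = w1 * (d - a) - 2 * (w2 * b) ->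
  E1 - B2 = w2 * (a - d) - 2 * (w1 * b) ->
  B11 - A12 = W11 * (d - a) + w1 * (E1 - A1) - 2 * (W12 * b + w2 * B1) ->
  B21 - A22 = W21 * (d - a) + w1 * (E2 - A2) - 2 * (W22 * b + w2 * B2) ->
  E11 - B12 = W12 * (a - d) + w2 * (A1 - E1) - 2 * (W11 * b + w1 * B1) ->
  E21 - B22 = W22 * (a - d) + w2 * (A2 - E2) - 2 * (W21 * b + w1 * B2) ->
  W12 - W21 = - w1 * w1 - w2 * w2 - (a * d - b * b) ->
  A12 - A21 = - w1 * A1 - w2 * A2 ->
  B12 - B21 = - w1 * B1 - w2 * B2 ->
  A1 + E1 = (a * x1 + b * x2) / 2 ->
  A2 + E2 = (b * x1 + d * x2) / 2 ->
  A11 + E11 = (A1 * x1 + a * (1 + w1 * x2 - a * y) + (B1 * x2 + b * (- w1 * x1 - b * y))) / 2 ->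
  A21 + E21 = (A2 * x1 + a * (w2 * x2 - b * y) + (B2 * x2 + b * (1 - w2 * x1 - d * y))) / 2 ->
  A22 + E22 = (B2 * x1 + b * (w2 * x2 - b * y) + (E2 * x2 + d * (1 - w2 * x1 - d * y))) / 2 ->
  a * A1 + 2 * (b * B1) + d * E1 = 0 ->
  a * A2 + 2 * (b * B2) + d * E2 = 0 ->
  A1 * A1 + a * A11 + 2 * (B1 * B1 + b * B11) + (E1 * E1 + d * E11) = 0 ->
  A2 * A2 + a * A22 + 2 * (B2 * B2 + b * B22) + (E2 * E2 + d * E22) = 0 ->
  (A1 - 2 * (w1 * b)) ^+ 2 + 2 * (B1 + w1 * (a - d)) ^+ 2 + (E1 + 2 * (w1 * b)) ^+ 2
  + ((A2 - 2 * (w2 * b)) ^+ 2 + 2 * (B2 + w2 * (a - d)) ^+ 2 + (E2 + 2 * (w2 * b)) ^+ 2)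
  = c ^+ 2 - c / 2 - lam * (a ^+ 3 + d ^+ 3 + 3 * (b ^+ 2 * (a + d))).
Proof.
move=> <- <- c1 c2 c11 c12 c21 c22 g cA cB m1 m2 m11 m21 m22 l1 l2 l11 l22.
(* Modulo the commutators, the Codazzi equations exchange the second derivatives
   of a, b, d with those of the trace, so that their traces can be eliminated. *)
have dA : A11 + A22 = (A11 + E11) - (E11 - B12) - (B21 - A22) - (B12 - B21) by ring.
have dE : E11 + E22 = (A22 + E22) + (E11 - B12) + (B21 - A22) + (B12 - B21) by ring.
have dB : B11 + B22 = (A21 + E21) + (B11 - A12) - (E21 - B22) + (A12 - A21) by ring.
rewrite m11 c21 c12 cB in dA; rewrite m22 c21 c12 cB in dE; rewrite m21 c11 c22 cA in dB.
have {l11 l22} L : A1 * A1 + 2 * (B1 * B1) + E1 * E1 + (A2 * A2 + 2 * (B2 * B2) + E2 * E2)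
   + a * (A11 + A22) + 2 * (b * (B11 + B22)) + d * (E11 + E22) = 0.
  by have := congr2 +%R l11 l22; rewrite addr0 => <-; ring.
rewrite dA dE dB {dA dE dB} in L.
have {}g : W12 = W21 - w1 * w1 - w2 * w2 - (a * d - b * b) by lra.
rewrite g {g} in L.
have e1 : E1 = B2 + (w2 * (a - d) - 2 * (w1 * b)) by rewrite -c2; ring.
have a2 : A2 = B1 - (w1 * (d - a) - 2 * (w2 * b)) by rewrite -c1; ring.
have a1 : A1 = (a * x1 + b * x2) / 2 - E1 by rewrite -m1; ring.
have e2 : E2 = (b * x1 + d * x2) / 2 - A2 by rewrite -m2; ring.
(* The identity holds modulo L and the first derivatives l1, l2 of tr (B^2) / 2:
   the coefficients come from the derivative of B along the tangential part of the
   position (x1, x2) and along D1 e1 + D2 e2 (w1, w2). *)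
rewrite -[RHS]addr0 -[in RHS]L -[RHS]addr0 -[in RHS](mulr0 (w2 - x1 / 2)) -[in RHS]l1.
rewrite -[RHS]addr0 -[in RHS](mulr0 (- w1 - x2 / 2)) -[in RHS]l2.
rewrite e2 a1 a2 e1.
by field.
Qed.

Section FrameCalculus.
Variable R : realType.
Notation T := 'rV[R]_3.
Implicit Types (P : T -> Prop) (Sm : (T -> R) -> Prop) (D : (T -> R) -> T -> R).
Implicit Types (F G : T -> R) (X Y : T -> T).

(** In this part a function on the surface is represented by an ambient function
    in the class Sm, and two functions are identified when they agree on P. *)
Record function_algebra Sm : Prop := FunctionAlgebra {
  fa_cst : forall k, Sm (fun=> k);
  fa_add : forall F G, Sm F -> Sm G -> Sm (fun q => F q + G q);
  fa_mul : forall F G, Sm F -> Sm G -> Sm (fun q => F q * G q) }.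

(** The field [der_ext] says that the derivation acts on classes of functions
    modulo equality on P. *)
Record derivation P Sm D : Prop := Derivation {
  der_closed : forall F, Sm F -> Sm (D F);
  der_ext : forall F G, Sm F -> Sm G -> (forall q, P q -> F q = G q) ->
    forall q, P q -> D F q = D G q;
  der_cst : forall k q, P q -> D (fun=> k) q = 0;
  der_add : forall F G, Sm F -> Sm G -> forall q, P q ->
    D (fun q => F q + G q) q = D F q + D G q;
  der_mul : forall F G, Sm F -> Sm G -> forall q, P q ->
    D (fun q => F q * G q) q = D F q * G q + F q * D G q }.

(** A relational form of D F = F' on P, from which the derivative of a composite
    expression is obtained by composing the rules below. *)
Definition isder P Sm D F F' := Sm F /\ forall q, P q -> D F q = F' q.

Definition fieldD D X : T -> T := fun q => \row_k D (fun q => X q 0 k) q.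
Definition smooth_field Sm X := forall k, Sm (fun q => X q 0 k).

Section Rules.
Variables (P : T -> Prop) (Sm : (T -> R) -> Prop) (D : (T -> R) -> T -> R).
Hypotheses (algS : function_algebra Sm) (derD : derivation P Sm D).

Lemma isder_self F : Sm F -> isder P Sm D F (D F).
Proof. by move=> sF; split. Qed.

Lemma isder_cst k : isder P Sm D (fun=> k) (fun=> 0).
Proof. by split; [exact: fa_cst | move=> q Pq; exact: (der_cst derD)]. Qed.

Lemma isder_add F G F' G' : isder P Sm D F F' -> isder P Sm D G G' ->
  isder P Sm D (fun q => F q + G q) (fun q => F' q + G' q).
Proof.
move=> [sF eF] [sG eG]; split; first exact: fa_add.
by move=> q Pq; rewrite (der_add derD)// eF// eG.
Qed.

Lemma isder_mul F G F' G' : isder P Sm D F F' -> isder P Sm D G G' ->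
  isder P Sm D (fun q => F q * G q) (fun q => F' q * G q + F q * G' q).
Proof.
move=> [sF eF] [sG eG]; split; first exact: fa_mul.
by move=> q Pq; rewrite (der_mul derD)// eF// eG.
Qed.

Lemma isder_opp F F' : isder P Sm D F F' ->
  isder P Sm D (fun q => - F q) (fun q => - F' q).
Proof.
move=> dF; have -> : (fun q => - F q) = (fun q => -1 * F q).
  by apply/funext => q; rewrite mulN1r.
have [sF eF] := isder_mul (isder_cst (-1)) dF; split=> // q Pq.
by rewrite eF// mul0r add0r mulN1r.
Qed.

(** Equations on P can be differentiated. *)
Lemma isder_eq F G F' G' : (forall q, P q -> F q = G q) ->
  isder P Sm D F F' -> isder P Sm D G G' -> forall q, P q -> F' q = G' q.
Proof.
move=> FG [sF eF] [sG eG] q Pq; rewrite -eF// -eG//; exact: (der_ext derD).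
Qed.

Lemma smooth_fieldD X : smooth_field Sm X -> smooth_field Sm (fieldD D X).
Proof.
move=> sX k; have -> : (fun q => fieldD D X q 0 k) = D (fun q => X q 0 k).
  by apply/funext => q; rewrite mxE.
exact: (der_closed derD).
Qed.

Lemma isder_dot X Y : smooth_field Sm X -> smooth_field Sm Y ->
  isder P Sm D (fun q => dot (X q) (Y q))
     (fun q => dot (fieldD D X q) (Y q) + dot (X q) (fieldD D Y q)).
Proof.
move=> sX sY.
have -> : (fun q => dot (X q) (Y q)) = (fun q => X q 0 0 * Y q 0 0 +
    X q 0 1 * Y q 0 1 + X q 0 (inord 2) * Y q 0 (inord 2)).
  by apply/funext => q; rewrite /dot sum3E.
have m k := isder_mul (isder_self (sX k)) (isder_self (sY k)).
have [sF eF] := isder_add (isder_add (m 0) (m 1)) (m (inord 2)).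
split=> // q Pq; rewrite eF// /dot -big_split sum3E.
by rewrite !mxE.
Qed.

End Rules.

(** An orthonormal frame (E1, E2, N) along P, with derivations D1, D2 in the
    directions E1, E2; the fields [of_dx1] and [of_dx2] identify these directions
    by the derivatives of the position. *)
Record moving_frame P Sm (D1 D2 : (T -> R) -> T -> R) (N E1 E2 : T -> T) : Prop := MovingFrame {
  of_alg : function_algebra Sm;
  of_der1 : derivation P Sm D1;
  of_der2 : derivation P Sm D2;
  of_smN : smooth_field Sm N;
  of_smE1 : smooth_field Sm E1;
  of_smE2 : smooth_field Sm E2;
  of_smx : smooth_field Sm id;
  of_dx1 : forall q, P q -> fieldD D1 id q = E1 q;
  of_dx2 : forall q, P q -> fieldD D2 id q = E2 q;
  of_orth : forall q, P q -> orthonormal3 (E1 q) (E2 q) (N q) }.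

Section Coefficients.
Variables (P : T -> Prop) (Sm : (T -> R) -> Prop) (D1 D2 : (T -> R) -> T -> R).
Variables (N E1 E2 : T -> T).
Hypothesis fr : moving_frame P Sm D1 D2 N E1 E2.
Let alg := of_alg fr.
Let sN := of_smN fr.
Let s1 := of_smE1 fr.
Let s2 := of_smE2 fr.

Lemma derivative_dot_cst D X Y k : derivation P Sm D ->
  smooth_field Sm X -> smooth_field Sm Y ->
  (forall q, P q -> dot (X q) (Y q) = k) ->
  forall q, P q -> dot (fieldD D X q) (Y q) = - dot (fieldD D Y q) (X q).
Proof.
move=> dD sX sY e q Pq.
have /(_ q Pq) /= := isder_eq dD e (isder_dot alg dD sX sY) (isder_cst alg dD k).
by rewrite (dotC (X q)) => /eqP; rewrite addr_eq0 => /eqP.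
Qed.

Lemma derivative_unit D X k : derivation P Sm D -> smooth_field Sm X ->
  (forall q, P q -> dot (X q) (X q) = k) ->
  forall q, P q -> dot (fieldD D X q) (X q) = 0.
Proof.
move=> dD sX e q Pq.
have := derivative_dot_cst dD sX sX e Pq; move: (dot _ _) => t; lra.
Qed.

Let orth q (Pq : P q) := of_orth fr Pq.

(** The derivatives of the constants <E_i, E_j>, <E_i, N>, <N, N> vanish. *)
Lemma frame_coefficients D : derivation P Sm D -> forall q, P q ->
  [/\ dot (fieldD D N q) (N q) = 0, dot (fieldD D E1 q) (E1 q) = 0 &
      dot (fieldD D E2 q) (E2 q) = 0] /\
  [/\ dot (fieldD D E1 q) (N q) = - dot (fieldD D N q) (E1 q),
      dot (fieldD D E2 q) (N q) = - dot (fieldD D N q) (E2 q) &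
      dot (fieldD D E2 q) (E1 q) = - dot (fieldD D E1 q) (E2 q)].
Proof.
move=> dD q Pq; split; split.
- by apply: (derivative_unit (k := 1) dD sN) => // z /orth [] [].
- by apply: (derivative_unit (k := 1) dD s1) => // z /orth [] [].
- by apply: (derivative_unit (k := 1) dD s2) => // z /orth [] [].
- by apply: (derivative_dot_cst (k := 0) dD s1 sN) => // z /orth [] _ [].
- by apply: (derivative_dot_cst (k := 0) dD s2 sN) => // z /orth [] _ [].
- by apply: (derivative_dot_cst (k := 0) dD s2 s1) => // z /orth [] _ []; rewrite dotC.
Qed.

End Coefficients.

(** The two properties of a frame tangent to a surface: the second fundamental
    form is symmetric, and the connection is torsion free, i.e. the bracket of E1
    and E2 is - w1 E1 - w2 E2 with w_i = <D_i E1, E2>. *)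
Record surface_frame P Sm (D1 D2 : (T -> R) -> T -> R) (N E1 E2 : T -> T) : Prop := SurfaceFrame {
  of_pre :> moving_frame P Sm D1 D2 N E1 E2;
  of_sym : forall q, P q -> dot (fieldD D1 N q) (E2 q) = dot (fieldD D2 N q) (E1 q);
  of_comm : forall F, Sm F -> forall q, P q -> D1 (D2 F) q - D2 (D1 F) q =
     - dot (fieldD D1 E1 q) (E2 q) * D1 F q - dot (fieldD D2 E1 q) (E2 q) * D2 F q }.

(** The trace of the cube of a symmetric 2x2 matrix with trace h whose square has
    trace c. *)
Definition cubic_trace (c h : R) := h * (3 * c - h ^+ 2) / 2.

Section Structure.
Variables (P : T -> Prop) (Sm : (T -> R) -> Prop) (D1 D2 : (T -> R) -> T -> R).
Variables (N E1 E2 : T -> T).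
Hypothesis fr : surface_frame P Sm D1 D2 N E1 E2.
Let alg := of_alg fr.
Let dD1 := of_der1 fr.
Let dD2 := of_der2 fr.
Let sN := of_smN fr.
Let s1 := of_smE1 fr.
Let s2 := of_smE2 fr.
Let sx := of_smx fr.

Let a q := dot (fieldD D1 N q) (E1 q).
Let b q := dot (fieldD D1 N q) (E2 q).
Let d q := dot (fieldD D2 N q) (E2 q).
Let w1 q := dot (fieldD D1 E1 q) (E2 q).
Let w2 q := dot (fieldD D2 E1 q) (E2 q).
Let x1 q := dot q (E1 q).
Let x2 q := dot q (E2 q).
Let y q := dot q (N q).

Let orth q (Pq : P q) := of_orth fr Pq.

Lemma isder_dot_frame D D' X Y : derivation P Sm D -> derivation P Sm D' ->
  smooth_field Sm X -> smooth_field Sm Y ->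
  isder P Sm D (fun q => dot (fieldD D' X q) (Y q))
   (fun q => dot (fieldD D (fieldD D' X) q) (Y q) +
     (dot (fieldD D' X q) (E1 q) * dot (fieldD D Y q) (E1 q) +
      dot (fieldD D' X q) (E2 q) * dot (fieldD D Y q) (E2 q) +
      dot (fieldD D' X q) (N q) * dot (fieldD D Y q) (N q))).
Proof.
move=> dD dD' sX sY.
have [sF eF] := isder_dot alg dD (smooth_fieldD dD' sX) sY.
split=> // q Pq; rewrite eF//; congr (_ + _).
exact/orthonormal3_dot/orth.
Qed.

Lemma field_comm X : smooth_field Sm X -> forall q, P q ->
  fieldD D1 (fieldD D2 X) q - fieldD D2 (fieldD D1 X) q =
   - w1 q *: fieldD D1 X q - w2 q *: fieldD D2 X q.
Proof.
move=> sX q Pq; apply/rowP => k; rewrite !mxE.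
have e D : (fun z => fieldD D X z 0 k) = D (fun z => X z 0 k).
  by apply/funext => z; rewrite mxE.
by rewrite !e (of_comm fr (sX k) Pq).
Qed.

Lemma field_comm_dot X v : smooth_field Sm X -> forall q, P q ->
  dot (fieldD D1 (fieldD D2 X) q) v - dot (fieldD D2 (fieldD D1 X) q) v =
   - w1 q * dot (fieldD D1 X q) v - w2 q * dot (fieldD D2 X q) v.
Proof.
move=> sX q Pq; have := congr1 (fun u => dot u v) (field_comm sX Pq).
by rewrite !dotDl !dotNl !dotZl mulNr.
Qed.

Let bE q : P q -> dot (fieldD D2 N q) (E1 q) = b q.
Proof. by move=> Pq; rewrite -(of_sym fr Pq). Qed.

(** The commutator of D1 and D2, applied to N and to E1. *)
Lemma codazzi_gauss q : P q ->
  [/\ D1 b q - D2 a q = w1 q * (d q - a q) - 2 * (w2 q * b q),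
      D1 d q - D2 b q = w2 q * (a q - d q) - 2 * (w1 q * b q) &
      D1 w2 q - D2 w1 q = - w1 q * w1 q - w2 q * w2 q - (a q * d q - b q * b q)].
Proof.
move=> Pq.
have [ [N1 E11 E21] [EN1 EN1' EE1]] := frame_coefficients fr dD1 Pq.
have [ [N2 E12 E22] [EN2 EN2' EE2]] := frame_coefficients fr dD2 Pq.
have eb : D1 b q = D1 (fun q => dot (fieldD D2 N q) (E1 q)) q.
  apply: (der_ext dD1 _ _ _ Pq) => [||z Pz]; last by rewrite bE.
  - by case: (isder_dot alg dD1 (smooth_fieldD dD1 sN) s2).
  - by case: (isder_dot alg dD1 (smooth_fieldD dD2 sN) s1).
split.
- rewrite eb (isder_dot_frame dD1 dD2 sN s1).2// (isder_dot_frame dD2 dD1 sN s1).2//.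
  have := field_comm_dot (E1 q) sN Pq.
  rewrite ?N1 ?N2 ?E11 ?E12 ?E21 ?E22 ?EN1 ?EN1' ?EN2 ?EN2' ?EE1 ?EE2 ?bE// -/(a q) -/(b q) -/(d q) -/(w1 q) -/(w2 q) => h.
  by lra.
- rewrite (isder_dot_frame dD1 dD2 sN s2).2// (isder_dot_frame dD2 dD1 sN s2).2//.
  have := field_comm_dot (E2 q) sN Pq.
  rewrite ?N1 ?N2 ?E11 ?E12 ?E21 ?E22 ?EN1 ?EN1' ?EN2 ?EN2' ?EE1 ?EE2 ?bE// -/(a q) -/(b q) -/(d q) -/(w1 q) -/(w2 q) => h.
  by lra.
- rewrite (isder_dot_frame dD1 dD2 s1 s2).2// (isder_dot_frame dD2 dD1 s1 s2).2//.
  have := field_comm_dot (E2 q) s1 Pq.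
  rewrite ?N1 ?N2 ?E11 ?E12 ?E21 ?E22 ?EN1 ?EN1' ?EN2 ?EN2' ?EE1 ?EE2 ?bE// -/(a q) -/(b q) -/(d q) -/(w1 q) -/(w2 q) => h.
  by lra.
Qed.

(** The position x satisfies D_i x = E_i, so its components in the frame are
    differentiated through the frame alone. *)
Lemma position_derivatives q : P q ->
  [/\ D1 x1 q = 1 + w1 q * x2 q - a q * y q,
      D2 x1 q = w2 q * x2 q - b q * y q,
      D1 x2 q = - w1 q * x1 q - b q * y q &
      D2 x2 q = 1 - w2 q * x1 q - d q * y q] /\
  D1 y q = a q * x1 q + b q * x2 q /\ D2 y q = b q * x1 q + d q * x2 q.
Proof.
move=> Pq.
have [ [N1 E11 E21] [EN1 EN1' EE1]] := frame_coefficients fr dD1 Pq.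
have [ [N2 E12 E22] [EN2 EN2' EE2]] := frame_coefficients fr dD2 Pq.
have [[d11 d22 d33] [d12 d13 d23]] := orth Pq.
have rule D Y : derivation P Sm D -> smooth_field Sm Y ->
    D (fun q => dot q (Y q)) q = dot (fieldD D id q) (Y q) +
    (x1 q * dot (fieldD D Y q) (E1 q) + x2 q * dot (fieldD D Y q) (E2 q) +
     y q * dot (fieldD D Y q) (N q)).
  move=> dD sY; rewrite (isder_dot alg dD sx sY).2//; congr (_ + _).
  exact/orthonormal3_dot/orth.
rewrite !rule// (of_dx1 fr)// (of_dx2 fr)// -/(y q).
rewrite ?N1 ?N2 ?E11 ?E12 ?E21 ?E22 ?EN1 ?EN1' ?EN2 ?EN2' ?EE1 ?EE2 ?bE// d11 d22 d12 d13 d23.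
rewrite (dotC (E2 q)) d12 -/(a q) -/(b q) -/(d q) -/(w1 q) -/(w2 q).
by do !split; ring.
Qed.

Variables (lam c : R).
Hypothesis mean : forall q, P q -> a q + d q - y q / 2 = lam.
Hypothesis len : forall q, P q -> a q * a q + 2 * (b q * b q) + d q * d q = c.

Let sa : Sm a. Proof. exact: (isder_dot alg dD1 (smooth_fieldD dD1 sN) s1).1. Qed.
Let sb : Sm b. Proof. exact: (isder_dot alg dD1 (smooth_fieldD dD1 sN) s2).1. Qed.
Let sd : Sm d. Proof. exact: (isder_dot alg dD1 (smooth_fieldD dD2 sN) s2).1. Qed.
Let sw1 : Sm w1. Proof. exact: (isder_dot alg dD1 (smooth_fieldD dD1 s1) s2).1. Qed.
Let sw2 : Sm w2. Proof. exact: (isder_dot alg dD1 (smooth_fieldD dD2 s1) s2).1. Qed.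
Let sx1 : Sm x1. Proof. exact: (isder_dot alg dD1 sx s1).1. Qed.
Let sx2 : Sm x2. Proof. exact: (isder_dot alg dD1 sx s2).1. Qed.
Let sy : Sm y. Proof. exact: (isder_dot alg dD1 sx sN).1. Qed.

Let H q := lam + dot q (N q) / 2.

(** The gradient of H is half the image by B of the tangential part of the
    position, and H is also the trace a + d. *)
Lemma mean_curvature_gradient q : P q ->
  [/\ D1 H q = (a q * x1 q + b q * x2 q) / 2,
      D2 H q = (b q * x1 q + d q * x2 q) / 2,
      D1 a q + D1 d q = (a q * x1 q + b q * x2 q) / 2 &
      D2 a q + D2 d q = (b q * x1 q + d q * x2 q) / 2].
Proof.
move=> Pq; have [_ [y1 y2]] := position_derivatives Pq.
have dH D (dD : derivation P Sm D) := isder_add alg dD (isder_cst alg dD lam)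
  (isder_mul alg dD (isder_self P D sy) (isder_cst alg dD 2^-1)).
have eH z : P z -> lam + y z * 2^-1 = a z + d z by move=> /mean <-; rewrite subrK.
have ad D (dD : derivation P Sm D) := isder_eq dD eH (dH D dD)
  (isder_add alg dD (isder_self P D sa) (isder_self P D sd)).
have hD D (dD : derivation P Sm D) : D H q = D y q / 2.
  by have /= := (dH D dD).2 q Pq; rewrite mulr0 addr0 add0r.
have {}ad D (dD : derivation P Sm D) : D a q + D d q = D y q / 2.
  by have /= := ad D dD q Pq; rewrite mulr0 addr0 add0r.
by rewrite !hD// !ad// y1 y2; split.
Qed.

(** Second derivatives of the equations of the surface; the first component is
    the identity (1) above.  The scalar quantities a, b, d, w1, ... depend on the
    point here, and [simons_jet] is applied to their values and derivatives at q. *)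
Lemma second_form_jet q : P q ->
  [/\ (D1 a q - 2 * (w1 q * b q)) ^+ 2 + 2 * (D1 b q + w1 q * (a q - d q)) ^+ 2 +
      (D1 d q + 2 * (w1 q * b q)) ^+ 2
    + ((D2 a q - 2 * (w2 q * b q)) ^+ 2 + 2 * (D2 b q + w2 q * (a q - d q)) ^+ 2 +
      (D2 d q + 2 * (w2 q * b q)) ^+ 2)
    = c ^+ 2 - c / 2 - lam * (a q ^+ 3 + d q ^+ 3 + 3 * (b q ^+ 2 * (a q + d q))),
    a q * D1 a q + 2 * (b q * D1 b q) + d q * D1 d q = 0,
    a q * D2 a q + 2 * (b q * D2 b q) + d q * D2 d q = 0 &
    D1 (D1 H) q + D2 (D2 H) q =
    (D1 a q * x1 q + a q * (1 + w1 q * x2 q - a q * y q) +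
      (D1 b q * x2 q + b q * (- w1 q * x1 q - b q * y q)) +
    (D2 b q * x1 q + b q * (w2 q * x2 q - b q * y q) +
      (D2 d q * x2 q + d q * (1 - w2 q * x1 q - d q * y q)))) / 2].
Proof.
move=> Pq.
have sD1 F (sF : Sm F) : Sm (D1 F) := der_closed dD1 sF.
have sD2 F (sF : Sm F) : Sm (D2 F) := der_closed dD2 sF.
have m1 z : P z -> D1 a z + D1 d z = (a z * x1 z + b z * x2 z) * 2^-1.
  by move=> /mean_curvature_gradient[].
have m2 z : P z -> D2 a z + D2 d z = (b z * x1 z + d z * x2 z) * 2^-1.
  by move=> /mean_curvature_gradient[].
have c1 z : P z -> D1 b z + -1 * D2 a z =
    w1 z * (d z + -1 * a z) + (-2) * (w2 z * b z).
  by move=> /codazzi_gauss[] c1 _ _; lra.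
have c2 z : P z -> D1 d z + -1 * D2 b z =
    w2 z * (a z + -1 * d z) + (-2) * (w1 z * b z).
  by move=> /codazzi_gauss[] _ c2 _; lra.
have dsum D (dD : derivation P Sm D) F G (sF : Sm F) (sG : Sm G) :=
  isder_add alg dD (isder_self P D sF) (isder_self P D sG).
have ddif D (dD : derivation P Sm D) F G (sF : Sm F) (sG : Sm G) :=
  isder_add alg dD (isder_self P D sF)
    (isder_mul alg dD (isder_cst alg dD (-1)) (isder_self P D sG)).
have dmul D (dD : derivation P Sm D) F G (sF : Sm F) (sG : Sm G) :=
  isder_mul alg dD (isder_self P D sF) (isder_self P D sG).
have dm1 D (dD : derivation P Sm D) := isder_eq dD m1 (dsum D dD _ _ (sD1 _ sa) (sD1 _ sd))
  (isder_mul alg dD (isder_add alg dD (dmul D dD _ _ sa sx1) (dmul D dD _ _ sb sx2))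
     (isder_cst alg dD 2^-1)).
have dm2 D (dD : derivation P Sm D) := isder_eq dD m2 (dsum D dD _ _ (sD2 _ sa) (sD2 _ sd))
  (isder_mul alg dD (isder_add alg dD (dmul D dD _ _ sb sx1) (dmul D dD _ _ sd sx2))
     (isder_cst alg dD 2^-1)).
have dc1 D (dD : derivation P Sm D) := isder_eq dD c1 (ddif D dD _ _ (sD1 _ sb) (sD2 _ sa))
  (isder_add alg dD (isder_mul alg dD (isder_self P D sw1) (ddif D dD _ _ sd sa))
     (isder_mul alg dD (isder_cst alg dD (-2)) (dmul D dD _ _ sw2 sb))).
have dc2 D (dD : derivation P Sm D) := isder_eq dD c2 (ddif D dD _ _ (sD1 _ sd) (sD2 _ sb))
  (isder_add alg dD (isder_mul alg dD (isder_self P D sw2) (ddif D dD _ _ sa sd))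
     (isder_mul alg dD (isder_cst alg dD (-2)) (dmul D dD _ _ sw1 sb))).
have dl D (dD : derivation P Sm D) := isder_eq dD len
  (isder_add alg dD (isder_add alg dD (dmul D dD _ _ sa sa)
     (isder_mul alg dD (isder_cst alg dD 2) (dmul D dD _ _ sb sb))) (dmul D dD _ _ sd sd))
  (isder_cst alg dD c).
have l D (dD : derivation P Sm D) z : P z ->
   a z * D a z + 2 * (b z * D b z) + d z * D d z = 0.
  by move=> /(dl D dD); move: (D a z) (D b z) (D d z) => u v w /= h; lra.
have ddl D (dD : derivation P Sm D) := isder_eq dD (l D dD)
  (isder_add alg dD (isder_add alg dD (dmul D dD _ _ sa (der_closed dD sa))
     (isder_mul alg dD (isder_cst alg dD 2) (dmul D dD _ _ sb (der_closed dD sb))))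
     (dmul D dD _ _ sd (der_closed dD sd)))
  (isder_cst alg dD 0).
have h1 z : P z -> D1 H z = (a z * x1 z + b z * x2 z) * 2^-1.
  by move=> /mean_curvature_gradient[].
have h2 z : P z -> D2 H z = (b z * x1 z + d z * x2 z) * 2^-1.
  by move=> /mean_curvature_gradient[].
have sH : Sm H := (isder_add alg dD1 (isder_cst alg dD1 lam)
  (isder_mul alg dD1 (isder_self P D1 sy) (isder_cst alg dD1 2^-1))).1.
have dh1 := isder_eq dD1 h1 (isder_self P D1 (sD1 _ sH))
  (isder_mul alg dD1 (isder_add alg dD1 (dmul D1 dD1 _ _ sa sx1) (dmul D1 dD1 _ _ sb sx2))
     (isder_cst alg dD1 2^-1)).
have dh2 := isder_eq dD2 h2 (isder_self P D2 (sD2 _ sH))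
  (isder_mul alg dD2 (isder_add alg dD2 (dmul D2 dD2 _ _ sb sx1) (dmul D2 dD2 _ _ sd sx2))
     (isder_cst alg dD2 2^-1)).
have [ [X11 X12 X21 X22] _] := position_derivatives Pq.
have {}dh1 := dh1 q Pq; have {}dh2 := dh2 q Pq; rewrite /= in dh1 dh2.
rewrite X11 X21 in dh1; rewrite X12 X22 in dh2.
split; [|exact: l..|]; last by rewrite dh1 dh2; ring.
have [C1 C2 GG] := codazzi_gauss Pq.
have cA := of_comm fr sa Pq; have cB := of_comm fr sb Pq.
have := dm1 _ dD1 q Pq; have := dm1 _ dD2 q Pq; have := dm2 _ dD2 q Pq => /=.
rewrite X11 X12 X21 X22 !mulr0 !addr0 => M22 M21 M11.
have K11 := dc1 _ dD1 q Pq; have K12 := dc1 _ dD2 q Pq.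
have K21 := dc2 _ dD1 q Pq; have K22 := dc2 _ dD2 q Pq; rewrite /= in K11 K12 K21 K22.
have L1 := l _ dD1 q Pq; have L2 := l _ dD2 q Pq.
have L11 := ddl _ dD1 q Pq; have L22 := ddl _ dD2 q Pq; rewrite /= in L11 L22.
have [_ _ G1 G2] := mean_curvature_gradient Pq.
have LL := len Pq; have MM := mean Pq.
clear - C1 C2 GG cA cB M22 M21 M11 K11 K12 K21 K22 L1 L2 L11 L22 G1 G2 LL MM.
rewrite -/(w1 q) -/(w2 q) in cA cB.
move: (D1 (D1 a) q) (D1 (D2 a) q) (D2 (D1 a) q) (D2 (D2 a) q)
  (D1 (D1 b) q) (D1 (D2 b) q) (D2 (D1 b) q) (D2 (D2 b) q)
  (D1 (D1 d) q) (D1 (D2 d) q) (D2 (D1 d) q) (D2 (D2 d) q)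
  (D1 a q) (D2 a q) (D1 b q) (D2 b q) (D1 d q) (D2 d q)
  (D1 w1 q) (D1 w2 q) (D2 w1 q) (D2 w2 q) (a q) (b q) (d q) (w1 q) (w2 q)
  (x1 q) (x2 q) (y q) C1 C2 GG cA cB M22 M21 M11 K11 K12 K21 K22 L1 L2 L11 L22 G1 G2 LL MM.
move=> a11 a12 a21 a22 b11 b12 b21 b22 e11 e12 e21 e22 a1 a2 b1 b2 e1 e2 w11 w12 w21 w22.
move=> a0 b0 d0 v1 v2 z1 z2 y0 C1 C2 GG cA cB M22 M21 M11 K11 K12 K21 K22 L1 L2 L11 L22 G1 G2 LL MM.
have {}K11 : b11 - a12 = w11 * (d0 - a0) + v1 * (e1 - a1) - 2 * (w12 * b0 + v2 * b1).
  by move: K11; rewrite !mul0r !mulN1r !add0r mulNr.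
have {}K12 : b21 - a22 = w21 * (d0 - a0) + v1 * (e2 - a2) - 2 * (w22 * b0 + v2 * b2).
  by move: K12; rewrite !mul0r !mulN1r !add0r mulNr.
have {}K21 : e11 - b12 = w12 * (a0 - d0) + v2 * (a1 - e1) - 2 * (w11 * b0 + v1 * b1).
  by move: K21; rewrite !mul0r !mulN1r !add0r mulNr.
have {}K22 : e21 - b22 = w22 * (a0 - d0) + v2 * (a2 - e2) - 2 * (w21 * b0 + v1 * b2).
  by move: K22; rewrite !mul0r !mulN1r !add0r mulNr.
rewrite !mul0r !add0r in L11 L22.
exact: (simons_jet (x1 := z1) (x2 := z2) MM LL C1 C2 K11 K12 K21 K22 GG cA cB G1 G2
  M11 M21 M22 L1 L2 L11 L22).
Qed.

Lemma mean_curvatureE q : P q -> H q = a q + d q.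
Proof. by move=> Pq; rewrite /H -(mean Pq) subrK. Qed.

Lemma cubic_traceE q : P q ->
  cubic_trace c (H q) = a q ^+ 3 + d q ^+ 3 + 3 * (b q ^+ 2 * (a q + d q)).
Proof. by move=> Pq; rewrite mean_curvatureE// /cubic_trace -(len Pq); field. Qed.

Lemma frame_umbilic_bound q : P q -> H q ^+ 2 <= 2 * c.
Proof.
move=> Pq; rewrite mean_curvatureE// -subr_ge0.
have -> : 2 * c - (a q + d q) ^+ 2 = (a q - d q) ^+ 2 + (2 * b q) ^+ 2.
  by rewrite -(len Pq); ring.
by rewrite addr_ge0 ?sqr_ge0.
Qed.

(** Each derivative of H is a trace of a component of nabla B, and
    (tr M)^2 <= 2 |M|^2 for a 2x2 matrix M. *)
Lemma frame_gradient_bound q : P q ->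
  D1 H q ^+ 2 + D2 H q ^+ 2 <= 2 * (c ^+ 2 - c / 2 - lam * cubic_trace c (H q)).
Proof.
move=> Pq; have [jet _ _ _] := second_form_jet Pq.
have [h1 h2 m1 m2] := mean_curvature_gradient Pq.
rewrite cubic_traceE// -jet h1 h2 -m1 -m2 -subr_ge0.
set p1 := D1 a q - _; set q1 := D1 b q + _; set r1 := D1 d q + _.
set p2 := D2 a q - _; set q2 := D2 b q + _; set r2 := D2 d q + _.
have -> : D1 a q + D1 d q = p1 + r1 by rewrite /p1 /r1; ring.
have -> : D2 a q + D2 d q = p2 + r2 by rewrite /p2 /r2; ring.
rewrite (_ : _ - _ = (p1 - r1) ^+ 2 + (2 * q1) ^+ 2 + ((p2 - r2) ^+ 2 + (2 * q2) ^+ 2)).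
  by rewrite !addr_ge0 ?sqr_ge0.
by ring.
Qed.

(** At a critical point of H the covariant derivatives of B are trace free, and
    the Codazzi equations express them by two numbers p1, q1.  Constancy of
    tr (B^2) is a linear system in (p1, q1) with determinant
    (a - d)^2 + 4 b^2 = 2 c - H^2, so p1 = q1 = 0. *)
Lemma frame_critical_nonumbilic q : P q -> D1 H q = 0 -> D2 H q = 0 ->
  H q ^+ 2 < 2 * c -> c ^+ 2 - c / 2 = lam * cubic_trace c (H q).
Proof.
move=> Pq; have [jet l1 l2 _] := second_form_jet Pq.
have [-> -> m1 m2] := mean_curvature_gradient Pq.
rewrite -m1 -m2 mean_curvatureE// => {}m1 {}m2 umb.
have [C1 C2 _] := codazzi_gauss Pq.
have ct := cubic_traceE Pq; rewrite mean_curvatureE// in ct.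
apply/eqP; rewrite -subr_eq0 ct -jet {ct}.
set p1 := D1 a q - _ in jet *; set q1 := D1 b q + _; set r1 := D1 d q + _.
set p2 := D2 a q - _; set q2 := D2 b q + _; set r2 := D2 d q + _.
have e1 : r1 = - p1 by rewrite /r1 /p1; lra.
have e2 : r2 = - p2 by rewrite /r2 /p2; lra.
have e3 : p2 = q1 by rewrite /p2 /q1; lra.
have e4 : q2 = - p1 by rewrite -e1 /q2 /r1; lra.
have e5 : (a q - d q) * p1 + 2 * b q * q1 = 0.
  have -> : (a q - d q) * p1 + 2 * b q * q1 = a q * p1 + 2 * b q * q1 + d q * r1.
    by rewrite e1; ring.
  by rewrite -l1 /p1 /q1 /r1; ring.
have e6 : (a q - d q) * q1 - 2 * b q * p1 = 0.
  have -> : (a q - d q) * q1 - 2 * b q * p1 = a q * p2 + 2 * b q * q2 + d q * r2.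
    by rewrite e2 e3 e4; ring.
  by rewrite -l2 /p2 /q2 /r2; ring.
have nz : 2 * c - (a q + d q) ^+ 2 != 0 by rewrite gt_eqF// subr_gt0.
have cE : 2 * c - (a q + d q) ^+ 2 = (a q - d q) ^+ 2 + 4 * b q ^+ 2.
  by rewrite -(len Pq); ring.
have p0 : p1 = 0.
  apply: (mulfI nz); rewrite mulr0 cE.
  rewrite (_ : _ * p1 = (a q - d q) * ((a q - d q) * p1 + 2 * b q * q1) -
     2 * b q * ((a q - d q) * q1 - 2 * b q * p1)); last by ring.
  by rewrite e5 e6 !mulr0 subr0.
have q0 : q1 = 0.
  apply: (mulfI nz); rewrite mulr0 cE.
  rewrite (_ : _ * q1 = (a q - d q) * ((a q - d q) * q1 - 2 * b q * p1) +
     2 * b q * ((a q - d q) * p1 + 2 * b q * q1)); last by ring.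
  by rewrite e5 e6 !mulr0 addr0.
by rewrite e1 e2 e3 e4 p0 q0; apply/eqP; ring.
Qed.

(** The derivative of the equation grad H = B x / 2 (tangential part of x): the
    terms with nabla B are grad H terms by Codazzi, and vanish. *)
Lemma frame_critical_laplacian q : P q -> D1 H q = 0 -> D2 H q = 0 ->
  D1 (D1 H) q + D2 (D2 H) q = (2^-1 - c) * H q + c * lam.
Proof.
move=> Pq; have [_ _ _ ->] := second_form_jet Pq.
have [-> -> m1 m2] := mean_curvature_gradient Pq => {}h1 {}h2.
have g1 : a q * x1 q + b q * x2 q = 0 by lra.
have g2 : b q * x1 q + d q * x2 q = 0 by lra.
rewrite g1 g2 mul0r in m1 m2.
have [C1 C2 _] := codazzi_gauss Pq.
have eE : D1 d q = - D1 a q by lra.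
have fE : D2 d q = - D2 a q by lra.
have B2 : D2 b q = - D1 a q - (w2 q * (a q - d q) - 2 * (w1 q * b q)) by lra.
have B1 : D1 b q = D2 a q + (w1 q * (d q - a q) - 2 * (w2 q * b q)) by lra.
rewrite mean_curvatureE// -(mean Pq) -(len Pq) B1 B2 fE.
apply/eqP; rewrite -subr_eq0; apply/eqP.
rewrite (_ : _ - _ = - w2 q / 2 * (a q * x1 q + b q * x2 q) +
   w1 q / 2 * (b q * x1 q + d q * x2 q)); first by rewrite g1 g2 !mulr0 addr0.
by field.
Qed.

End Structure.
End FrameCalculus.

(** * Orthonormal frames of an embedded surface *)

Section AdaptedFrame.
Context {R : realType}.
Notation T := 'rV[R]_3.
Implicit Types (S V : set T) (N : T -> T).

Definition gradient (F : T -> R) (z : T) : T := \row_k 'D_(delta_mx 0 k) F z.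

Lemma derive_gradient (F : T -> R) z v : differentiable F z ->
  'D_v F z = dot v (gradient F z).
Proof. by move=> dF; rewrite derive_rowE//; apply: eq_bigr => k _; rewrite mxE. Qed.

Lemma gradient_derivable V (F : T -> R) q v : open V -> smooth V F -> V q ->
  derivable (gradient F) q v.
Proof.
move=> oV sF Vq; apply/derivable_mxP => i k.
have -> : (fun z => gradient F z i k) = fun z => 'D_(delta_mx 0 k) F z.
  by apply/funext => z; rewrite mxE.
exact: smooth_derivable (smooth_derive _ sF) Vq.
Qed.

(** Differentiation of <Y, grad F> by the product rule. *)
Lemma derive_field_gradient V (F : T -> R) (Y : T -> T) q u : open V -> V q ->
  smooth V F -> smooth V Y ->
  'D_u (fun z => 'D_(Y z) F z) q =
  dot ('D_u Y q) (gradient F q) + dot (Y q) ('D_u (gradient F) q).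
Proof.
move=> oV Vq sF sY.
rewrite -(derive_dot (smooth_derivable sY Vq) (gradient_derivable oV sF Vq)).
apply: near_eq_derive.
have nV : \forall z \near q, V z by exact: open_nbhs_nbhs.
near=> z; apply: derive_gradient; apply: smooth_differentiable sF _.
by near: z.
Unshelve. all: by end_near. Qed.

Lemma derive_derive_field V (F : T -> R) (Y : T -> T) q u : open V -> V q ->
  smooth V F -> smooth V Y ->
  'D_u (fun z => 'D_(Y z) F z) q = 'D_('D_u Y q) F q + 'D_u (fun z => 'D_(Y q) F z) q.
Proof.
move=> oV Vq sF sY.
apply: (etrans (derive_field_gradient u oV Vq sF sY)); congr (_ + _).
  by rewrite derive_gradient//; exact: smooth_differentiable sF Vq.
apply: esym.
apply: (etrans (derive_field_gradient u oV Vq sF (@smooth_cst _ _ _ V (Y q)))).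
have -> : 'D_u (fun=> Y q) q = 0 :> T by exact: (derive_cst (Y q) q u).
by rewrite dot0l add0r.
Qed.

(** A smooth frame of the surface S on an open set V, extended to the ambient
    space; only its values on S are constrained. *)
Record adapted_frame S V (N E1 E2 : T -> T) : Prop := AdaptedFrame {
  af_open : open V;
  af_smN : smooth V N;
  af_sm1 : smooth V E1;
  af_sm2 : smooth V E2;
  af_normal : normal_along S V N;
  af_tan1 : forall q, S q -> V q -> tangent S q (E1 q);
  af_tan2 : forall q, S q -> V q -> tangent S q (E2 q);
  af_orth : forall q, S q -> V q -> orthonormal3 (E1 q) (E2 q) (N q) }.

Lemma fieldD_derive V (E X : T -> T) q : V q -> smooth V X ->
  fieldD (fun F z => 'D_(E z) F z) X q = 'D_(E q) X q.
Proof.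
move=> Vq sX; apply/rowP => k; rewrite mxE derive_coord//.
exact: smooth_derivable sX Vq.
Qed.

Section Instance.
Variables (S V : set T) (N E1 E2 : T -> T).
Hypotheses (emb : embedded_surface S) (af : adapted_frame S V N E1 E2).
Let oV := af_open af.
Let P q := S q /\ V q.
Let D1 (F : T -> R) q := 'D_(E1 q) F q.
Let D2 (F : T -> R) q := 'D_(E2 q) F q.
Let Sm (F : T -> R) := smooth V F.

Lemma smooth_function_algebra : function_algebra Sm.
Proof.
split=> [k|F G sF sG|F G sF sG]; [exact: smooth_cst|exact: smoothD|exact: smoothM].
Qed.

(** Compatibility with equality on S is [derive_tangent]. *)
Lemma tangential_derivation (E : T -> T) : smooth V E ->
  (forall q, S q -> V q -> tangent S q (E q)) ->
  derivation P Sm (fun F q => 'D_(E q) F q).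
Proof.
move=> sE tE; split.
- by move=> F sF; exact: smooth_derive_field.
- move=> F G sF sG FG q [Sq Vq].
  apply: (derive_tangent oV Vq) => [z Sz Vz|||]; last exact: tE.
  + exact: FG.
  + exact: smooth_differentiable sF Vq.
  + exact: smooth_differentiable sG Vq.
- by move=> k q _; exact: (derive_cst k q).
- move=> F G sF sG q [Sq Vq]; rewrite -deriveD//.
    exact: smooth_derivable sF Vq.
  exact: smooth_derivable sG Vq.
- move=> F G sF sG q [Sq Vq].
  apply: (etrans (deriveM (smooth_derivable sF Vq) (smooth_derivable sG Vq))).
  by rewrite addrC; congr (_ + _); exact: mulrC.
Qed.

Lemma adapted_moving_frame : moving_frame P Sm D1 D2 N E1 E2.
Proof.
have sf (X : T -> T) : smooth V X -> smooth_field Sm X.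
  by move=> sX k; exact: smooth_coord.
split.
- exact: smooth_function_algebra.
- exact: tangential_derivation (af_sm1 af) (af_tan1 af).
- exact: tangential_derivation (af_sm2 af) (af_tan2 af).
- exact/sf/(af_smN af).
- exact/sf/(af_sm1 af).
- exact/sf/(af_sm2 af).
- exact/sf/smooth_id.
- move=> q [Sq Vq]; rewrite (fieldD_derive _ Vq (smooth_id oV)); exact: derive_id.
- move=> q [Sq Vq]; rewrite (fieldD_derive _ Vq (smooth_id oV)); exact: derive_id.
- by move=> q [Sq Vq]; exact: (af_orth af).
Qed.

(** The ambient second derivative of F is symmetric, so the commutator of D1 and
    D2 is the derivative along D1 E2 - D2 E1.  The normal component of this vector
    vanishes by symmetry of the second fundamental form. *)
Lemma adapted_surface_frame : surface_frame P Sm D1 D2 N E1 E2.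
Proof.
have pre := adapted_moving_frame.
have sym q : P q -> dot (fieldD D1 N q) (E2 q) = dot (fieldD D2 N q) (E1 q).
  move=> [Sq Vq]; rewrite !(fieldD_derive _ Vq (af_smN af)).
  exact: shape_symmetric emb Sq oV Vq (af_smN af) (af_normal af) (af_orth af Sq Vq).
split => // F sF q Pq; have [Sq Vq] := Pq.
have dF : differentiable F q by exact: smooth_differentiable sF Vq.
have e12 := derive_derive_field (E1 q) oV Vq sF (af_sm2 af).
have e21 := derive_derive_field (E2 q) oV Vq sF (af_sm1 af).
have e21' := etrans e21 (congr1 (fun a => 'D_('D_(E2 q) E1 q) F q + a)
  (esym (derive_commute (E1 q) (E2 q) oV Vq sF))).
apply: (etrans (congr2 (fun a b : R => a - b) e12 e21')).
have cancel (x y z : R) : x + z - (y + z) = x - y by ring.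
apply: (etrans (cancel _ _ _)) => {e12 e21 e21' cancel}.
have XE : 'D_(E1 q) E2 q = fieldD D1 E2 q by rewrite (fieldD_derive _ Vq (af_sm2 af)).
have YE : 'D_(E2 q) E1 q = fieldD D2 E1 q by rewrite (fieldD_derive _ Vq (af_sm1 af)).
have -> : 'D_('D_(E1 q) E2 q) F q - 'D_('D_(E2 q) E1 q) F q =
    'd F q (fieldD D1 E2 q - fieldD D2 E1 q).
  by rewrite linearB XE YE; congr (_ - _); exact: deriveE.
have -> : D1 F q = 'd F q (E1 q) by exact: deriveE.
have -> : D2 F q = 'd F q (E2 q) by exact: deriveE.
have [ [_ _ b2] [_ b4 b5]] := frame_coefficients pre (of_der1 pre) Pq.
have [ [_ a1 _] [a3 _ _]] := frame_coefficients pre (of_der2 pre) Pq.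
have symq := sym q Pq; have ortho := af_orth af Sq Vq.
clear - b2 b4 b5 a1 a3 symq ortho; move: b2 b4 b5 a1 a3 symq ortho.
move: (fieldD D1 E2 q) (fieldD D2 E1 q) (fieldD D1 E1 q) (fieldD D1 N q) (fieldD D2 N q)
  (E1 q) (E2 q) (N q) => X Y Z W1 W2 e1 e2 m b2 b4 b5 a1 a3 symq ortho.
rewrite (orthonormal3_expand (X - Y) ortho) !dotDl !dotNl a1 b2 b4 a3 b5 symq.
rewrite subrr subr0 sub0r scale0r addr0 linearD.
by congr (_ + _); last rewrite -mulNr; exact: linearZ.
Qed.

End Instance.
End AdaptedFrame.

(** * Second-order conditions at extrema *)

Section SecondOrder.
Context {R : realType}.
Notation T := 'rV[R]_3.
Implicit Types (S V : set T) (N : T -> T).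

(** If the second derivative were negative, dg would be negative just to the right
    of 0, and g would decrease there by the mean value theorem. *)
Lemma second_derivative_at_min (g dg : R -> R) (eps : R) : 0 < eps ->
  (forall t : R, `|t| < eps -> is_derive t 1 g (dg t)) -> derivable dg (0 : R) 1 ->
  (forall t, `|t| < eps -> g 0 <= g t) -> dg 0 = 0 /\ 0 <= 'D_1 dg (0 : R).
Proof.
move=> e0 der ddg gmin.
have itv t : t \in `]-eps, eps[%R -> `|t| < eps by rewrite in_itv /= ltr_norml.
have dg0 : dg 0 = 0.
  have z0 : 0 \in `](-eps), eps[%R by rewrite in_itv /= oppr_lt0 e0.
  have [_ <-] : is_derive (0 : R) 1 g (dg 0) by apply: der; rewrite normr0.
  have [|||_ d0] := @derive1_at_min R g (-eps) eps 0 _ _ z0 _.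
  - by rewrite ge0_cp// ltW.
  - by move=> t /itv /der [].
  - by move=> t /itv; exact: gmin.
  - exact: d0.
split=> //; rewrite leNgt; apply/negP => neg.
have cvd : (fun h => h^-1 *: (dg (h *: 1 + 0) - dg 0)) @ (0 : R)^' --> 'D_1 dg 0 by exact: ddg.
have : \forall h \near (0:R)^', h^-1 *: (dg (h *: 1 + 0) - dg 0) < 0.
  exact: (cvgr_lt _ cvd).
move=> /nbhs_ballP[d /= d0 hd].
pose t := Num.min d eps / 2.
have t0 : 0 < t by rewrite divr_gt0// lt_min d0.
have m0 : 0 < Num.min d eps by rewrite lt_min d0.
have tm : t < Num.min d eps by rewrite /t ltr_pdivrMr// ltr_pMr// ltr1n.
have te : t < eps by apply: lt_le_trans tm _; rewrite ge_min lexx orbT.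
have td : t < d by apply: lt_le_trans tm _; rewrite ge_min lexx.
have [||c ct e] := @MVT R g dg 0 t t0.
- move=> x; rewrite in_itv /= => /andP[x0 xt]; apply: der.
  by rewrite gtr0_norm// (lt_trans xt).
- apply: derivable_within_continuous => x; rewrite in_itv /= => /andP[x0 xt].
  by have dx := der x; apply: (@ex_derive _ _ _ _ _ _ (dg x)); apply: dx; rewrite ger0_norm// (le_lt_trans xt).
move: ct; rewrite in_itv /= => /andP[c0 ct].
have dc : dg c < 0.
  have := hd c; rewrite /= -ball_normE /ball_ /= sub0r normrN gtr0_norm//.
  move=> /(_ (lt_trans ct td)); rewrite gt_eqF// => /(_ isT).
  rewrite dg0 subr0 addr0 [c *: 1]mulr1 => h.
  by have : c^-1 * dg c < 0 by []; rewrite pmulr_rlt0// invr_gt0.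
have := gmin t; rewrite gtr0_norm// => /(_ te).
by rewrite -subr_ge0 e subr0 leNgt nmulr_rlt0// t0.
Qed.

(** The change of basis is orthogonal.  This compares the frames that come with the
    curvature hypotheses at nearby points with one smooth frame. *)
Lemma frame_change (L : {linear T -> T}) (e1 e2 f1 f2 m : T) :
  orthonormal3 e1 e2 m -> orthonormal3 f1 f2 m -> dot (L e1) e2 = dot (L e2) e1 ->
  dot (L f1) f1 + dot (L f2) f2 = dot (L e1) e1 + dot (L e2) e2 /\
  dot (L f1) f1 ^+ 2 + dot (L f1) f2 ^+ 2 + (dot (L f2) f1 ^+ 2 + dot (L f2) f2 ^+ 2) =
  dot (L e1) e1 * dot (L e1) e1 + 2 * (dot (L e1) e2 * dot (L e1) e2) +
  dot (L e2) e2 * dot (L e2) e2.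
Proof.
move=> oe of_ sym.
have [ [f11 f22 fm] [f12 f1m f2m] ] := of_.
have [ [e11 e22 em] [e12 e1m e2m] ] := oe.
(* The rows of the change of basis are orthonormal, hence so are its columns. *)
have P11 := orthonormal3_dot e1 e1 of_; have P12 := orthonormal3_dot e1 e2 of_.
have P22 := orthonormal3_dot e2 e2 of_.
rewrite e11 e1m mulr0 addr0 in P11; rewrite e12 e1m mul0r addr0 in P12.
rewrite e22 e2m mulr0 addr0 in P22.
have lin a b c d : dot (L (a *: e1 + b *: e2)) (c *: e1 + d *: e2) =
   a * c * dot (L e1) e1 + (a * d + b * c) * dot (L e1) e2 + b * d * dot (L e2) e2.
  rewrite linearD !linearZ !dotDl !dotDr !dotZl !dotZr -sym.
  by move: (dot _ _) (dot _ _) (dot _ _) => x y z; ring.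
have F1 : f1 = dot f1 e1 *: e1 + dot f1 e2 *: e2.
  by rewrite [LHS](orthonormal3_expand f1 oe) f1m scale0r addr0.
have F2 : f2 = dot f2 e1 *: e1 + dot f2 e2 *: e2.
  by rewrite [LHS](orthonormal3_expand f2 oe) f2m scale0r addr0.
move: P11 P12 P22 F1 F2; rewrite !(dotC e1) !(dotC e2).
move: (dot f1 e1) (dot f1 e2) (dot f2 e1) (dot f2 e2) => a b c d P11 P12 P22 F1 F2.
rewrite F1 F2 !lin; move: (dot (L e1) e1) (dot (L e1) e2) (dot (L e2) e2) => x y z.
split.
  have -> : x + z = (a * a + c * c) * x + 2 * (a * b + c * d) * y + (b * b + d * d) * z.
    by rewrite -P11 -P12 -P22; ring.
  by ring.
have -> : x * x + 2 * (y * y) + z * z =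
  (a * a + c * c) ^+ 2 * (x * x) + 2 * (((a * a + c * c) * (b * b + d * d) + (a * b + c * d) ^+ 2) * (y * y)) +
  (b * b + d * d) ^+ 2 * (z * z) + 4 * ((a * a + c * c) * (a * b + c * d) * (x * y)) +
  2 * ((a * b + c * d) ^+ 2 * (x * z)) + 4 * ((b * b + d * d) * (a * b + c * d) * (y * z)).
  by rewrite -P11 -P12 -P22; ring.
by ring.
Qed.

End SecondOrder.

Section Minimum.
Context {R : realType}.
Notation T := 'rV[R]_3.
Implicit Types (S V : set T) (N : T -> T).

(** Along a curve in S with velocity E p at p, the second derivative of F is that of
    F along the field E plus the derivative of F in the direction
    w = gamma'' - D_E E.  The normal components of gamma'' and D_E E are both given
    by the second fundamental form, so w is tangent. *)
Lemma minimum_along_tangent S V N (F : T -> R) (E : T -> T) p :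
  open V -> V p -> smooth V F -> smooth V E -> smooth V N -> normal_along S V N ->
  tangent S p (E p) ->
  dot ('D_(E p) E p) (N p) = - dot ('D_(E p) N p) (E p) ->
  (forall q, S q -> V q -> F p <= F q) ->
  'D_(E p) F p = 0 /\
  exists2 w, dot w (N p) = 0 & 0 <= 'D_(E p) (fun z => 'D_(E z) F z) p + 'D_w F p.
Proof.
move=> oV Vp sF sE sN nN [eps [gam [e0 sg gS g0 gv]]] EN Fmin.
have cg : {for (0 : R^o), continuous gam}.
  by apply/differentiable_continuous/(smooth_differentiable sg); exact: ballxx.
have nV : \forall t \near (0 : R^o), V (gam t).
  by apply: cg; rewrite g0; exact: open_nbhs_nbhs.
have [d d0 dV] : exists2 d : R, 0 < d & forall t : R^o, `|t| < d -> ball (0 : R^o) eps t /\ V (gam t).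
  have /nbhs_ballP[d /= d0 dV] : \forall t \near (0 : R^o), ball (0 : R^o) eps t /\ V (gam t).
    by apply: filterI nV; exact: nbhsx_ballx.
  exists d => // t td; apply: dV; rewrite -ball_normE /ball_ /=.
  by rewrite sub0r normrN.
have dgam (t : R^o) : `|t| < d -> differentiable gam t.
  by move=> /dV[bt _]; exact: smooth_differentiable sg bt.
pose dg (t : R^o) : R := dot ('D_1 gam t) (gradient F (gam t)).
have der (t : R^o) : `|t| < d -> is_derive t 1 (F \o gam) (dg t).
  move=> td; have [bt Vt] := dV t td.
  have dF : differentiable F (gam t) by exact: smooth_differentiable sF Vt.
  apply: DeriveDef.
    by apply: diff_derivable; apply: differentiable_comp => //; exact: dgam.
  apply: (etrans (@derive_comp _ R^o _ _ F gam t 1 (dgam _ td) dF)).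
  exact: derive_gradient.
have n0 : `|0 : R^o| < d by rewrite normr0.
have b0 : ball (0 : R^o) eps 0 by exact: ballxx.
have dG1 : derivable (fun t : R^o => 'D_1 gam t) 0 1.
  exact: smooth_derivable (smooth_derive _ sg) b0.
have dgrad k : differentiable (fun z => 'D_(delta_mx 0 k) F z) (gam 0).
  by rewrite g0; exact: smooth_differentiable (smooth_derive _ sF) Vp.
have dG2k i k : derivable (fun t : R^o => gradient F (gam t) i k) 0 1.
  have -> : (fun t : R^o => gradient F (gam t) i k) = (fun z => 'D_(delta_mx 0 k) F z) \o gam.
    by apply/funext => z; rewrite mxE.
  by apply: diff_derivable; apply: differentiable_comp; [exact: dgam|exact: dgrad].
have dG2 : derivable (fun t : R^o => gradient F (gam t)) 0 1.
  by apply/derivable_mxP => i k; exact: dG2k.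
have G2E : 'D_1 (fun t : R^o => gradient F (gam t)) 0 = 'D_(E p) (gradient F) p.
  apply/rowP => k.
  apply: (etrans (esym (derive_coord 0 k dG2))); apply: esym.
  apply: (etrans (esym (derive_coord 0 k (gradient_derivable oV sF Vp)))); apply: esym.
  have eg : (fun t : R^o => gradient F (gam t) 0 k) = (fun z => 'D_(delta_mx 0 k) F z) \o gam.
    by apply/funext => z; rewrite mxE.
  have eG : (fun z => gradient F z 0 k) = (fun z => 'D_(delta_mx 0 k) F z).
    by apply/funext => z; rewrite mxE.
  rewrite eg eG.
  apply: (etrans (@derive_comp _ R^o _ _ _ gam 0 1 (dgam _ n0) (dgrad k))).
  by rewrite gv g0.
have Fm (t : R^o) : `|t| < d -> (F \o gam) 0 <= (F \o gam) t.
  by move=> /dV[bt Vt]; have := Fmin _ (gS t bt) Vt; rewrite -g0.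
have ddg : derivable dg (0 : R^o) 1 by exact: derivable_dot dG1 dG2.
have [z0 z1] := second_derivative_at_min d0 der ddg Fm.
rewrite /dg gv g0 in z0.
have dF : differentiable F p by exact: smooth_differentiable sF Vp.
split; first exact: (etrans (derive_gradient (E p) dF) z0).
have z1E : 'D_1 dg (0 : R^o) = dot ('D_1 (fun t : R^o => 'D_1 gam t) 0) (gradient F p) +
   dot (E p) ('D_(E p) (gradient F) p).
  by rewrite (derive_dot dG1 dG2) G2E gv g0.
have {}z1 : 0 <= 'D_1 dg (0 : R^o) by exact: z1.
exists ('D_1 (fun t : R^o => 'D_1 gam t) 0 - 'D_(E p) E p); last first.
  rewrite (derive_field_gradient _ oV Vp sF sE) (derive_gradient _ dF) dotDl dotNl.
  have cancel (x y z : R) : x + y + (z - x) = z + y by ring.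
  by rewrite cancel -z1E.
rewrite dotDl dotNl EN opprK.
have dN : differentiable N (gam 0) by rewrite g0; exact: smooth_differentiable sN Vp.
have dNg : derivable (N \o gam) (0 : R^o) 1.
  by apply: diff_derivable; apply: differentiable_comp; [exact: dgam|exact: dN].
have zero : 'D_1 (fun t : R^o => dot ('D_1 gam t) ((N \o gam) t)) 0 = 0.
  apply: (etrans _ (derive_cst (0 : R) (0 : R^o) (1 : R^o))); apply: near_eq_derive.
  have nd : \forall t \near (0 : R^o), `|t| < d.
    have : \forall t \near (0 : R^o), ball (0 : R^o) d t by exact: nbhsx_ballx.
    by apply: filterS => t; rewrite -ball_normE /ball_ /= sub0r normrN.
  apply: filterS nd => t /dV[bt Vt]; rewrite dotC; apply: (nN _ (gS t bt) Vt).
  by apply: smooth_image_tangent sg gS bt; exact: ball_open.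
have eN : 'D_1 (N \o gam) (0 : R^o) = 'D_(E p) N p.
  by apply: (etrans (@derive_comp _ R^o _ _ N gam 0 1 (dgam _ n0) dN)); rewrite gv g0.
have e0' : (N \o gam) (0 : R^o) = N p by rewrite -g0.
by rewrite (derive_dot dG1 dNg) eN gv e0' (dotC (E p)) in zero.
Qed.

End Minimum.

(** * Mean curvature and second fundamental form in a given frame *)

Lemma smooth_dot (R : realType) (V : normedModType R) (U : set V) (X Y : V -> 'rV[R]_3) :
  open U -> smooth U X -> smooth U Y -> smooth U (fun z => dot (X z) (Y z)).
Proof.
move=> oU sX sY.
have m k : smooth U (fun z => X z 0 k * Y z 0 k).
  by apply: smoothM => //; exact: smooth_coord.
apply: smooth_ext oU _ (smoothD oU (smoothD oU (m 0) (m 1)) (m (inord 2))) => z _.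
by rewrite /dot sum3E.
Qed.

Lemma derive_comb (R : realType) (V : normedModType R) (F : V -> R) (x e1 e2 : V) (a b : R) :
  differentiable F x ->
  'D_(a *: e1 + b *: e2) F x = a * 'D_e1 F x + b * 'D_e2 F x.
Proof. by move=> dF; rewrite !(deriveE _ dF) linearD; congr (_ + _); exact: linearZ. Qed.

Section LocalGeometry.
Context {R : realType}.
Notation T := 'rV[R]_3.
Variables (S : set T) (n : T -> T).
Hypotheses (emb : embedded_surface S) (nor : outward_unit_normal S n).

Lemma orthonormal_pair (e : 'I_2 -> T -> T) q : S q ->
  (forall i, tangent S q (e i q)) ->
  (forall i j, dot (e i q) (e j q) = (i == j)%:R) ->
  orthonormal3 (e 0 q) (e 1 q) (n q).
Proof.
move=> Sq te oe; have [_ nn nt _ _] := nor Sq.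
split; split; rewrite ?oe ?nn // dotC; exact/nt/te.
Qed.

(** Shrinking V, all the local extensions and the orthonormality relations hold
    on one open set. *)
Lemma adapted_frame_exists e p : S p -> orthonormal_frame S p e ->
  exists V N E1 E2, [/\ adapted_frame S V N E1 E2, V p & forall q, S q -> V q -> N q = n q].
Proof.
move=> Sp [sme oe].
have [[N [V0 [oV0 V0p sN eN]]] _ _ _ _] := nor Sp.
have [Y1 [V1 [oV1 V1p s1 e1]]] := sme 0.
have [Y2 [V2 [oV2 V2p s2 e2]]] := sme 1.
pose Q := [set q | S q -> (forall i, tangent S q (e i q)) /\
  (forall i j, dot (e i q) (e j q) = (i == j)%:R)].
have oQ : open Q° by exact: open_interior.
have hr q : Q° q -> Q q by exact: interior_subset.
have Qp : Q° p by exact: oe.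
pose V := V0 `&` V1 `&` V2 `&` Q°.
have nV q : S q -> V q -> [/\ N q = n q, Y1 q = e 0 q, Y2 q = e 1 q &
    (forall i, tangent S q (e i q)) /\
    (forall i j, dot (e i q) (e j q) = (i == j)%:R)].
  by move=> Sq [[[? ?] ?] bq]; split; [exact: eN|exact: e1|exact: e2|exact: hr].
have oV : open V by do !apply: openI.
exists V, N, Y1, Y2; split; last by move=> q Sq /(nV _ Sq)[].
- split=> //.
  + by apply: smooth_subset sN => q [[[]]].
  + by apply: smooth_subset s1 => q [[[]]].
  + by apply: smooth_subset s2 => q [[[]]].
  + move=> q Sq /(nV _ Sq)[-> _ _ _] v tv.
    by have [_ _ nt _ _] := nor Sq; exact: nt.
  + by move=> q Sq /(nV _ Sq)[_ -> _ [+ _]]; exact.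
  + by move=> q Sq /(nV _ Sq)[_ _ -> [+ _]]; exact.
  + by move=> q Sq /(nV _ Sq)[-> -> -> [te oq]]; exact: orthonormal_pair.
- by [].
Qed.

Section Frame.
Variables (V : set T) (N E1 E2 : T -> T).
Hypotheses (af : adapted_frame S V N E1 E2) (Nn : forall q, S q -> V q -> N q = n q).
Let oV := af_open af.

Lemma orthonormal_frame_at e q : S q -> orthonormal_frame S q e ->
  (forall i, tangent S q (e i q)) /\ orthonormal3 (e 0 q) (e 1 q) (n q).
Proof.
move=> Sq [_ /nbhs_singleton /(_ Sq) [te oe]]; split => //.
exact: orthonormal_pair.
Qed.

Lemma normal_extension q : S q -> V q -> local_extension S n q N.
Proof.
by move=> Sq Vq; exists V; split=> //; exact: (af_smN af).
Qed.

(** Differentiate <e j, n> = 0 along e i. *)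
Lemma second_form_coefE e q i j : S q -> V q -> orthonormal_frame S q e ->
  second_form_coef S n e q i j = - dot ('D_(e i q) N q) (e j q).
Proof.
move=> Sq Vq oe; have [te _] := orthonormal_frame_at Sq oe.
have [sme oe'] := oe.
pose Q := [set q | S q -> (forall i, tangent S q (e i q)) /\
  (forall i j, dot (e i q) (e j q) = (i == j)%:R)].
have oQ : open Q° by exact: open_interior.
have hr z : Q° z -> Q z by exact: interior_subset.
have Qq : Q° q by exact: oe'.
have [Z ext] := sme j.
have [W [oW Wq sZ eZ]] := ext.
have dN := smooth_derivable (v := e i q) (af_smN af) Vq.
have dZ := smooth_derivable (v := e i q) sZ Wq.
rewrite /second_form_coef (nablaE (te i) ext) -(Nn Sq Vq).
have zero : 'D_(e i q) (fun z => dot (Z z) (N z)) q = 0.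
  apply: (etrans _ (derive_cst (0 : R) q (e i q))).
  apply: (@derive_tangent _ _ S (V `&` W `&` Q°)) => //.
  - by do !apply: openI.
  - move=> z Sz [[Vz Wz] bz]; rewrite eZ// Nn// dotC.
    by have [_ _ nt _ _] := nor Sz; apply: nt; have [] := hr z bz Sz.
  - have oVW : open (V `&` W) by exact: openI.
    apply: (@smooth_differentiable _ _ _ (V `&` W)) => //.
    by apply: smooth_dot => //; [apply: smooth_subset sZ|apply: smooth_subset (af_smN af)] => z [].
have := derive_dot dZ dN; rewrite zero => /esym /eqP; rewrite addr_eq0 => /eqP ->.
by rewrite dotC eZ.
Qed.

(** The curvature hypotheses at q come with a frame of their own. *)
Lemma frame_at_change e q : S q -> V q -> orthonormal_frame S q e ->
  let b i j := dot ('D_(e i q) N q) (e j q) in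
  b 0 0 + b 1 1 = dot ('D_(E1 q) N q) (E1 q) + dot ('D_(E2 q) N q) (E2 q) /\
  b 0 0 ^+ 2 + b 0 1 ^+ 2 + (b 1 0 ^+ 2 + b 1 1 ^+ 2) =
  dot ('D_(E1 q) N q) (E1 q) * dot ('D_(E1 q) N q) (E1 q) +
  2 * (dot ('D_(E1 q) N q) (E2 q) * dot ('D_(E1 q) N q) (E2 q)) +
  dot ('D_(E2 q) N q) (E2 q) * dot ('D_(E2 q) N q) (E2 q).
Proof.
move=> Sq Vq oe /=; have [te orth] := orthonormal_frame_at Sq oe.
have dN : differentiable N q by exact: smooth_differentiable (af_smN af) Vq.
have orthE := af_orth af Sq Vq.
have sym := shape_symmetric emb Sq oV Vq (af_smN af) (af_normal af) orthE.
rewrite -(Nn Sq Vq) in orth.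
rewrite !(deriveE _ dN) in sym *.
exact: frame_change orthE orth sym.
Qed.

Lemma mean_curvature_frame q h : S q -> V q -> is_mean_curvature S n q h ->
  h = dot ('D_(E1 q) N q) (E1 q) + dot ('D_(E2 q) N q) (E2 q).
Proof.
move=> Sq Vq [e oe ->]; have [te _] := orthonormal_frame_at Sq oe.
have [<- _] := frame_at_change Sq Vq oe.
by rewrite /surface_div sum2E !(nablaE (te _) (normal_extension Sq Vq)).
Qed.

Lemma second_form_length_frame q l : S q -> V q -> is_second_form_length S n q l ->
  dot ('D_(E1 q) N q) (E1 q) * dot ('D_(E1 q) N q) (E1 q) +
  2 * (dot ('D_(E1 q) N q) (E2 q) * dot ('D_(E1 q) N q) (E2 q)) +
  dot ('D_(E2 q) N q) (E2 q) * dot ('D_(E2 q) N q) (E2 q) = l ^+ 2.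
Proof.
move=> Sq Vq [e oe ->].
have [_ <-] := frame_at_change Sq Vq oe.
rewrite sqr_sqrtr; last by apply: sumr_ge0 => i _; apply: sumr_ge0 => j _; exact: sqr_ge0.
have coef i j : second_form_coef S n e q i j ^+ 2 = dot ('D_(e i q) N q) (e j q) ^+ 2.
  by rewrite (second_form_coefE i j Sq Vq oe) sqrrN.
apply: esym; apply: (etrans (y := \sum_(i < 2) \sum_(j < 2) dot ('D_(e i q) N q) (e j q) ^+ 2)).
  by apply: eq_bigr => i _; apply: eq_bigr => j _; exact: coef.
by apply: (etrans (sum2E _)); apply: congr2; exact: sum2E.
Qed.

Let fr := adapted_surface_frame emb af.

(** At a minimum the first derivatives vanish in all tangent directions, in
    particular along the correction vectors w of [minimum_along_tangent]. *)
Lemma minimum_hessian (F : T -> R) p : smooth V F -> S p -> V p ->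
  (forall q, S q -> V q -> F p <= F q) ->
  [/\ 'D_(E1 p) F p = 0, 'D_(E2 p) F p = 0 &
    0 <= 'D_(E1 p) (fun z => 'D_(E1 z) F z) p + 'D_(E2 p) (fun z => 'D_(E2 z) F z) p].
Proof.
move=> sF Sp Vp Fmin.
have [_ [n1 _ _]] := frame_coefficients fr (of_der1 fr) (conj Sp Vp).
have [_ [_ n2 _]] := frame_coefficients fr (of_der2 fr) (conj Sp Vp).
rewrite (fieldD_derive _ Vp (af_sm1 af)) (fieldD_derive _ Vp (af_smN af)) in n1.
rewrite (fieldD_derive _ Vp (af_sm2 af)) (fieldD_derive _ Vp (af_smN af)) in n2.
have [z1 [w1 t1 p1]] := minimum_along_tangent oV Vp sF (af_sm1 af) (af_smN af)
  (af_normal af) (af_tan1 af Sp Vp) n1 Fmin.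
have [z2 [w2 t2 p2]] := minimum_along_tangent oV Vp sF (af_sm2 af) (af_smN af)
  (af_normal af) (af_tan2 af Sp Vp) n2 Fmin.
have dF : differentiable F p by exact: smooth_differentiable sF Vp.
have crit w : dot w (N p) = 0 -> 'D_w F p = 0.
  move=> wN; rewrite (orthonormal3_expand w (af_orth af Sp Vp)) wN scale0r addr0.
  by rewrite (derive_comb _ _ _ _ dF) z1 z2 !mulr0 addr0.
rewrite (crit w1 t1) addr0 in p1; rewrite (crit w2 t2) addr0 in p2.
split; [exact: z1|exact: z2|exact: addr_ge0 p1 p2].
Qed.

Lemma maximum_hessian (F : T -> R) p : smooth V F -> S p -> V p ->
  (forall q, S q -> V q -> F q <= F p) ->
  [/\ 'D_(E1 p) F p = 0, 'D_(E2 p) F p = 0 &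
    'D_(E1 p) (fun z => 'D_(E1 z) F z) p + 'D_(E2 p) (fun z => 'D_(E2 z) F z) p <= 0].
Proof.
move=> sF Sp Vp Fmax.
have alg := of_alg fr.
have sub D (dD : derivation (fun q => S q /\ V q) (fun F : T -> R => smooth V F) D) :
    smooth V (fun q => - F q) /\ D (fun q => - F q) p = - D F p /\
    D (D (fun q => - F q)) p = - D (D F) p.
  have [sNF eNF] := isder_opp alg dD (isder_self _ D sF).
  have sDF := der_closed dD sF.
  have [sNDF eNDF] := isder_opp alg dD (isder_self _ D sDF).
  split; [exact: sNF | split; first exact: eNF].
  apply: (etrans _ (eNDF p (conj Sp Vp))).
  exact: (der_ext dD (der_closed dD sNF) sNDF eNF (conj Sp Vp)).
have [sNF [a1 b1]] := sub _ (of_der1 fr).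
have [_ [a2 b2]] := sub _ (of_der2 fr).
have [|z1 z2 z3] := minimum_hessian sNF Sp Vp.
  by move=> q Sq Vq; rewrite lerN2; exact: Fmax.
split.
- by apply/eqP; rewrite -oppr_eq0 -a1 z1.
- by apply/eqP; rewrite -oppr_eq0 -a2 z2.
- have neg (x y x' y' : R) : x' = - x -> y' = - y -> 0 <= x' + y' -> x + y <= 0.
    by move=> -> ->; rewrite -opprD oppr_ge0.
  exact: neg b1 b2 z3.
Qed.

End Frame.
End LocalGeometry.

(** * Pointwise estimates on the mean curvature *)

Section PointwiseEstimates.
Context {R : realType}.
Notation T := 'rV[R]_3.
Variables (S : set T) (n : T -> T) (lam l : R).
Hypotheses (emb : embedded_surface S) (nor : outward_unit_normal S n).
Hypothesis mc : lambda_hypersurface S n lam.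
Hypothesis sl : forall p, S p -> is_second_form_length S n p l.
Local Notation c := (l ^+ 2).

(** The value of the mean curvature prescribed by the equation of a
    lambda-hypersurface; it extends smoothly wherever n does. *)
Definition support_mean q := lam + dot q (n q) / 2.
Local Notation h := support_mean.

Section Frame.
Variables (V : set T) (N E1 E2 : T -> T).
Hypotheses (af : adapted_frame S V N E1 E2) (Nn : forall q, S q -> V q -> N q = n q).
Let D1 (F : T -> R) q := 'D_(E1 q) F q.
Let D2 (F : T -> R) q := 'D_(E2 q) F q.
Let F q := lam + dot q (N q) / 2.

Lemma support_extension q : S q -> V q -> F q = h q.
Proof. by move=> Sq Vq; rewrite /F (Nn Sq Vq). Qed.

Lemma smooth_support_extension : smooth V F.
Proof.
have oV := af_open af.
apply: smoothD => //; first exact: smooth_cst.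
apply: smoothM => //; last exact: smooth_cst.
by apply: smooth_dot => //; [exact: smooth_id|exact: (af_smN af)].
Qed.

Lemma mean_equation q : S q /\ V q ->
  dot (fieldD D1 N q) (E1 q) + dot (fieldD D2 N q) (E2 q) - dot q (N q) / 2 = lam.
Proof.
move=> [Sq Vq]; rewrite !(fieldD_derive _ Vq (af_smN af)).
have [k mk <-] := mc Sq.
by rewrite -(mean_curvature_frame emb nor af Nn Sq Vq mk) Nn.
Qed.

Lemma length_equation q : S q /\ V q ->
  dot (fieldD D1 N q) (E1 q) * dot (fieldD D1 N q) (E1 q) +
  2 * (dot (fieldD D1 N q) (E2 q) * dot (fieldD D1 N q) (E2 q)) +
  dot (fieldD D2 N q) (E2 q) * dot (fieldD D2 N q) (E2 q) = c.
Proof.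
move=> [Sq Vq]; rewrite !(fieldD_derive _ Vq (af_smN af)).
exact: (second_form_length_frame emb nor af Nn Sq Vq (sl Sq)).
Qed.

End Frame.

Lemma adapted_frame_at p : S p -> exists V N E1 E2,
  [/\ adapted_frame S V N E1 E2, V p & forall q, S q -> V q -> N q = n q].
Proof. by move=> Sp; have [k [e oe _] _] := mc Sp; exact: adapted_frame_exists oe. Qed.

Lemma umbilic_bound p : S p -> h p ^+ 2 <= 2 * c.
Proof.
move=> Sp; have [V [N [E1 [E2 [af Vp Nn]]]]] := adapted_frame_at Sp.
rewrite -(support_extension Nn Sp Vp).
exact: (frame_umbilic_bound (mean_equation af Nn) (length_equation af Nn) (conj Sp Vp)).
Qed.

(** The bound of [frame_gradient_bound], combined with the Cauchy-Schwarz
    inequality for an arbitrary tangent vector. *)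
Lemma gradient_bound p : S p -> exists V F,
  [/\ open V, V p, smooth V F & forall q, S q -> V q -> F q = h q] /\
  forall v, tangent S p v ->
   'D_v F p ^+ 2 <= 2 * (c ^+ 2 - c / 2 - lam * cubic_trace c (h p)) * dot v v.
Proof.
move=> Sp; have [V [N [E1 [E2 [af Vp Nn]]]]] := adapted_frame_at Sp.
have fr := adapted_surface_frame emb af.
have gb := frame_gradient_bound fr (mean_equation af Nn) (length_equation af Nn) (conj Sp Vp).
have sF := smooth_support_extension af.
exists V, (fun q => lam + dot q (N q) / 2); split.
  by split; [exact: (af_open af)|exact: Vp|exact: sF|exact: support_extension Nn].
move=> v tv; rewrite -(support_extension Nn Sp Vp).
apply: le_trans (ler_wpM2r _ gb); last by apply: sumr_ge0 => i _; exact: sqr_ge0.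
have orth := af_orth af Sp Vp.
have vN : dot v (N p) = 0 by rewrite dotC; exact: (af_normal af Sp Vp tv).
have dF := smooth_differentiable sF Vp.
rewrite (orthonormal3_dot v v orth) vN mulr0 addr0.
rewrite {1}(orthonormal3_expand v orth) vN scale0r addr0 (derive_comb _ _ _ _ dF).
have cs (x y u w : R) : (x * u + y * w) ^+ 2 <= (u ^+ 2 + w ^+ 2) * (x * x + y * y).
  rewrite -subr_ge0 (_ : _ - _ = (x * w - y * u) ^+ 2); first exact: sqr_ge0.
  by ring.
exact: cs.
Qed.

Lemma deficit_ge0 p : S p -> 0 <= c ^+ 2 - c / 2 - lam * cubic_trace c (h p).
Proof.
move=> Sp; have [V [N [E1 [E2 [af Vp Nn]]]]] := adapted_frame_at Sp.
have fr := adapted_surface_frame emb af.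
have := frame_gradient_bound fr (mean_equation af Nn) (length_equation af Nn) (conj Sp Vp).
rewrite [lam + _](support_extension Nn Sp Vp) => gb.
rewrite -(pmulr_rge0 _ (ltr0Sn _ 1)); apply: le_trans gb.
by apply: addr_ge0; exact: sqr_ge0.
Qed.

Lemma minimum_point p : S p -> (forall q, S q -> h p <= h q) ->
  (h p ^+ 2 < 2 * c -> c ^+ 2 - c / 2 = lam * cubic_trace c (h p)) /\
  0 <= (2^-1 - c) * h p + c * lam.
Proof.
move=> Sp hmin; have [V [N [E1 [E2 [af Vp Nn]]]]] := adapted_frame_at Sp.
have fr := adapted_surface_frame emb af.
have [|z1 z2 z3] := minimum_hessian emb af (smooth_support_extension af) Sp Vp.
  move=> q Sq Vq; rewrite (support_extension Nn Sp Vp) (support_extension Nn Sq Vq).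
  exact: hmin.
have me := mean_equation af Nn; have le := length_equation af Nn.
rewrite -(support_extension Nn Sp Vp).
split; first exact: (frame_critical_nonumbilic fr me le (conj Sp Vp) z1 z2).
rewrite -(frame_critical_laplacian fr me le (conj Sp Vp) z1 z2); exact: z3.
Qed.

Lemma maximum_point p : S p -> (forall q, S q -> h q <= h p) ->
  (h p ^+ 2 < 2 * c -> c ^+ 2 - c / 2 = lam * cubic_trace c (h p)) /\
  (2^-1 - c) * h p + c * lam <= 0.
Proof.
move=> Sp hmax; have [V [N [E1 [E2 [af Vp Nn]]]]] := adapted_frame_at Sp.
have fr := adapted_surface_frame emb af.
have [|z1 z2 z3] := maximum_hessian emb af (smooth_support_extension af) Sp Vp.
  move=> q Sq Vq; rewrite (support_extension Nn Sp Vp) (support_extension Nn Sq Vq).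
  exact: hmax.
have me := mean_equation af Nn; have le := length_equation af Nn.
rewrite -(support_extension Nn Sp Vp).
split; first exact: (frame_critical_nonumbilic fr me le (conj Sp Vp) z1 z2).
rewrite -(frame_critical_laplacian fr me le (conj Sp Vp) z1 z2); exact: z3.
Qed.

End PointwiseEstimates.

(** * Propagation along a connected surface *)

Section Gronwall.
Context {R : realType}.
Notation T := 'rV[R]_3.

(** The function f^2 exp (- (K + 1) t) is nonincreasing, because
    2 f f' <= f^2 + f'^2 <= (K + 1) f^2, and it vanishes at 0. *)
Lemma gronwall_zero (f df : R -> R) (K : R) :
  (forall t : R, 0 <= t <= 1 -> is_derive t 1 f (df t)) ->
  (forall t, 0 <= t <= 1 -> df t ^+ 2 <= K * f t ^+ 2) -> f 0 = 0 -> f 1 = 0.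
Proof.
move=> der bnd f0; pose k := - (K + 1).
have dexp (t : R) : is_derive t 1 (fun s => expR (k * s)) (k * expR (k * t)).
  have dk : is_derive t 1 (fun s : R => k * s) k.
    have dk : is_derive t 1 (fun s : R => k * s) (k *: 1).
      exact: (@is_deriveZ _ _ _ (id : R -> R) k t 1 1 (is_derive_id t 1)).
    by apply: is_derive_eq dk _; exact: mulr1.
  rewrite mulrC; exact: (@is_derive1_comp _ expR (fun s => k * s) t _ _ (is_derive_expR _) dk).
have dpsi (t : R) : 0 <= t <= 1 -> is_derive t 1 (fun s => f s * f s * expR (k * s))
   ((2 * f t * df t + k * f t ^+ 2) * expR (k * t)).
  move=> t01; have dft := der t t01.
  have dff : is_derive t 1 (f * f) (f t *: df t + f t *: df t) by exact: is_deriveM.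
  have dm : is_derive t 1 (fun s => f s * f s * expR (k * s))
      (f t * f t * (k * expR (k * t)) + expR (k * t) * (f t * df t + f t * df t)).
    exact: (is_deriveM dff (dexp t)).
  by apply: is_derive_eq dm _; ring.
have [c c01 e] := mean_value_is_derive ltr01 dpsi.
move: e; rewrite f0 mul0r mul0r subr0 !mulr1 => e.
have le0 : 2 * f c * df c + k * f c ^+ 2 <= 0.
  have := bnd c c01; have := sqr_ge0 (f c - df c).
  have -> : (f c - df c) ^+ 2 = f c ^+ 2 + df c ^+ 2 - 2 * f c * df c by ring.
  rewrite /k; move: (f c ^+ 2) (df c ^+ 2) (2 * f c * df c) => x y z h1 h2; lra.
have : f 1 * f 1 * expR k <= 0.
  by rewrite e; apply: mulr_le0_ge0 le0 _; exact: expR_ge0.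
rewrite pmulr_lle0; last exact: expR_gt0.
rewrite -expr2 => h; apply/eqP; rewrite -sqrf_eq0 eq_le h /=; exact: sqr_ge0.
Qed.

Section Clopen.
Variables (S : set T) (h : T -> R).
Hypothesis ext : forall p, S p -> exists V F,
  [/\ open V, V p, smooth V F & forall q, S q -> V q -> F q = h q].

Lemma extension_near p (O : set R) : S p -> open O -> O (h p) ->
  \forall q \near p, S q -> O (h q).
Proof.
move=> Sp oO Op; have [V [F [oV Vp sF eF]]] := ext Sp.
have cF : F @ p --> F p := sF 0 p Vp.
have nO : \forall q \near p, O (F q).
  by apply: cF; apply: open_nbhs_nbhs; split; rewrite // eF.
have nV : \forall q \near p, V q by exact: open_nbhs_nbhs.
by apply: filterS2 nO nV => q Oq Vq Sq; rewrite -eF.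
Qed.

Lemma extension_continuous : {within S, continuous h}.
Proof.
apply/subspace_continuousP => p Sp O; rewrite nbhsE => -[W [ ooW Wp] WO].
apply: filterS (extension_near Sp ooW Wp) => q SqW Sq.
exact/WO/SqW.
Qed.

(** A and its complement in S are given as neighborhood conditions; the traces on
    S of the interiors below are the open and closed sets that connectedness asks
    for. *)
Lemma connected_clopen (A : set T) : connected S -> (exists2 z, S z & A z) ->
  (forall p, S p -> A p -> \forall q \near p, S q -> A q) ->
  (forall p, S p -> ~ A p -> \forall q \near p, S q -> ~ A q) ->
  forall q, S q -> A q.
Proof.
move=> cS [z Sz Az] opA opC.
pose C1 := [set q | S q -> A q]; pose C2 := [set q | S q -> ~ A q].
have sub1 q : C1° q -> C1 q by exact: interior_subset.
have sub2 q : C2° q -> C2 q by exact: interior_subset.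
suff : S `&` A = S by move=> SA q Sq; have [] : (S `&` A) q by rewrite SA.
apply: cS.
- by exists z.
- exists C1°; first exact: open_interior.
  apply/seteqP; split=> q [Sq]; first by move=> Aq; split => //; exact: opA.
  by move=> /sub1 /(_ Sq) Aq.
- exists (~` C2°); first by apply: open_closedC; exact: open_interior.
  apply/seteqP; split=> q [Sq].
    by move=> Aq; split => // /sub2 /(_ Sq).
  by move=> nC2; split => //; apply: contrapT => nA; apply: nC2; exact: opC.
Qed.

Lemma intermediate_value p q m : connected S -> S p -> S q -> h p <= m <= h q ->
  exists2 z, S z & h z = m.
Proof.
move=> cS Sp Sq /andP[pm mq]; apply: contrapT => none.
have ne z : S z -> h z <> m by move=> Sz zm; apply: none; exists z.
have lt_open : open [set x : R | x < m] by exact: open_lt.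
have gt_open : open [set x : R | m < x] by exact: open_gt.
have : h q < m.
  apply: (connected_clopen (A := [set z | h z < m]) cS _ _ _ Sq).
  - by exists p => //=; rewrite lt_neqAle pm andbT; apply/eqP/ne.
  - by move=> z Sz zm; exact: (extension_near Sz lt_open zm).
  - move=> z Sz /negP; rewrite -leNgt => mz.
    have {}mz : m < h z by rewrite lt_neqAle mz andbT eq_sym; apply/eqP/ne.
    apply: filterS (extension_near Sz gt_open mz) => y my Sy.
    by apply/negP; rewrite -leNgt ltW//; exact: my.
by rewrite ltNge mq.
Qed.

End Clopen.

End Gronwall.

Section Rigid.
Context {R : realType}.
Notation T := 'rV[R]_3.
Variables (S : set T) (h : T -> R) (C k : R).
Hypothesis emb : embedded_surface S.
Hypothesis C0 : 0 <= C.
Hypothesis bnd : forall p, S p -> exists V F,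
  [/\ open V, V p, smooth V F & forall q, S q -> V q -> F q = h q] /\
  forall v, tangent S p v -> 'D_v F p ^+ 2 <= C * (h p - k) ^+ 2 * dot v v.

(** Gronwall's inequality for h - k along the image of a segment.  The velocity of
    this curve is bounded because the segment is compact. *)
Lemma chart_segment_constant U V phi u v : local_parametrization S U V phi ->
  (forall t : R, 0 <= t <= 1 -> U (u + t *: v)) -> h (phi u) = k ->
  h (phi (u + v)) = k.
Proof.
move=> chart Ut hu; have [[oU oV im] [sphi _ _]] := chart.
have Sphi z : U z -> S (phi z) by move=> Uz; have [] : (S `&` V) (phi z) by rewrite -im; exists z.
pose sp (t : R) : R := dot ('D_v phi (u + t *: v)) ('D_v phi (u + t *: v)).
have csp : {within `[0, 1], continuous sp}.
  apply: derivable_within_continuous => t; rewrite in_itv /= => t01.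
  have dd : derivable (fun s : R => 'D_v phi (u + s *: v)) t 1.
    have ddp : differentiable (fun z => 'D_v phi z) (u + t *: v).
      exact: smooth_differentiable (smooth_derive v sphi) (Ut t t01).
    by case: (is_derive_line ddp).
  exact: (derivable_dot dd dd).
have [M [M0 hM]] : exists M : R, 0 <= M /\ forall t : R, 0 <= t <= 1 -> sp t <= M.
  have [t0 _ ht0] := EVT_max ler01 csp.
  exists (sp t0); split; first by apply: sumr_ge0 => i _; exact: sqr_ge0.
  by move=> t t01; apply: ht0; rewrite in_itv.
pose f (t : R) := h (phi (u + t *: v)) - k.
have main (t : R) : 0 <= t <= 1 -> exists2 d : R, is_derive t 1 f d & d ^+ 2 <= C * M * f t ^+ 2.
  move=> t01; have Uy := Ut t t01; have Sy := Sphi _ Uy.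
  have [W [F [[oW Wp sF FE] bF]]] := bnd Sy.
  have dphi : differentiable phi (u + t *: v) by exact: smooth_differentiable sphi Uy.
  have dF : differentiable F (phi (u + t *: v)) by exact: smooth_differentiable sF Wp.
  have dFphi : differentiable (F \o phi) (u + t *: v) by exact: differentiable_comp.
  exists ('D_('D_v phi (u + t *: v)) F (phi (u + t *: v))); last first.
    apply: le_trans (bF _ (chart_derivative_tangent v chart Uy)) _.
    rewrite -/(f t) -/(sp t) -[C * M * _]mulrAC.
    by apply: ler_wpM2l; [apply: mulr_ge0 => //; exact: sqr_ge0|exact: hM].
  have dl := is_derive_line dFphi.
  rewrite (derive_comp v dphi dF) in dl.
  have dk : is_derive t 1 (fun s : R => (F \o phi) (u + s *: v) - k)
     ('D_('D_v phi (u + t *: v)) F (phi (u + t *: v)) - 0).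
    exact: (is_deriveB dl (is_derive_cst k t 1)).
  rewrite subr0 in dk.
  apply: near_eq_is_derive dk.
  have cl : {for t, continuous (fun s : R => u + s *: v)}.
    exact/differentiable_continuous/differentiable_line.
  have cphi : {for u + t *: v, continuous phi} by exact/differentiable_continuous.
  have n1 : \forall s \near t, U (u + s *: v) by apply: cl; exact: open_nbhs_nbhs.
  have n2 : \forall s \near t, W (phi (u + s *: v)).
    have := continuous_comp cl cphi; apply; exact: open_nbhs_nbhs.
  by apply: filterS2 n1 n2 => s Us Ws; rewrite /f -FE//; exact: Sphi.
pose df (t : R) := if pselect (0 <= t <= 1) is left t01 then
  sval (cid2 (main t t01)) else 0.
have f1 : f 1 = 0.
  apply: (@gronwall_zero _ f df (C * M)).
  - by move=> t t01; rewrite /df; case: pselect => // t01'; case: cid2.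
  - by move=> t t01; rewrite /df; case: pselect => // t01'; case: cid2.
  - by rewrite /f scale0r addr0 hu subrr.
by apply/eqP; rewrite -subr_eq0; move: f1; rewrite /f scale1r => /eqP.
Qed.

(** The inverse of a chart is continuous, so the images of segments starting at
    phi^-1 (z) reach a whole neighborhood of z in S. *)
Lemma constant_near z : S z -> h z = k -> \forall q \near z, S q -> h q = k.
Proof.
move=> Sz hz; have [U [V [phi [Vz chart]]]] := emb Sz.
have [[oU oV im] [sphi _ [psi psiK /subspace_continuousP cpsi]]] := chart.
have [u Uu uz] : (phi @` U) z by rewrite im.
have [r r0 rU] := open_ball_subset oU Uu.
have psiz : psi z = u by rewrite -uz psiK.
have nb : \forall q \near z, (S `&` V) q -> ball u r (psi q).
  have SVz : (S `&` V) z by [].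
  have cz : psi @ within (S `&` V) (nbhs z) --> psi z := cpsi z SVz.
  rewrite psiz in cz.
  have /cz : nbhs u (ball u r) by exact: nbhsx_ballx.
  exact.
have nV : \forall q \near z, V q by exact: open_nbhs_nbhs.
apply: filterS2 nb nV => q hq Vq Sq.
have [w Uw wq] : (phi @` U) q by rewrite im.
have bw : ball u r w by have := hq (conj Sq Vq); rewrite -wq psiK.
rewrite -wq -(subrK u w) addrC; apply: (chart_segment_constant chart); last by rewrite uz.
move=> t /andP[t0 t1]; apply: rU; move: bw; rewrite -!ball_normE /ball_ /=.
rewrite opprD addNKr normrN normrZ ger0_norm// distrC.
by apply: le_lt_trans; rewrite ler_piMl.
Qed.

Lemma constant_of_gradient_bound z : connected S -> S z -> h z = k ->
  forall q, S q -> h q = k.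
Proof.
move=> cS Sz hz.
have ext p : S p -> exists V F,
    [/\ open V, V p, smooth V F & forall q, S q -> V q -> F q = h q].
  by move=> /bnd [V [F [e _]]]; exists V, F.
apply: (connected_clopen cS); first by exists z.
  by move=> p Sp hp; exact: constant_near.
have oO : open [set x : R | x != k] by exact: open_neq.
move=> p Sp /eqP hp; apply: filterS (extension_near ext Sp oO hp) => q hq Sq.
exact/eqP/hq.
Qed.

End Rigid.

(** * Points that are not enclosed *)

Section Enclosure.
Context {R : realType}.
Notation T := 'rV[R]_3.
Implicit Types (S : set T) (p q w : T).

Lemma dot_ge0 n (v : 'rV[R]_n) : 0 <= dot v v.
Proof. by apply: sumr_ge0 => i _; exact: sqr_ge0. Qed.

Lemma dot_eq0 n (v : 'rV[R]_n) : dot v v = 0 -> v = 0.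
Proof.
move=> v0; apply/rowP => i; apply/eqP; rewrite mxE -sqrf_eq0 expr2.
have /psumr_eq0P : forall i : 'I_n, true -> 0 <= v 0 i * v 0 i by move=> j _; exact: sqr_ge0.
by move=> /(_ v0 i isT) ->.
Qed.

Lemma connected_line (I : set R) (u v : T) : is_interval I ->
  connected [set u + t *: v | t in I].
Proof.
move=> iI; apply: (@connected_continuous_connected _ _ I (fun t : R => u + t *: v)).
  exact/connected_intervalP.
apply: continuous_subspaceT => t.
exact/differentiable_continuous/differentiable_line.
Qed.

Lemma unbounded_ray (A : set T) v : v != 0 ->
  (forall t : R, 1 <= t -> A (t *: v)) -> ~ bounded_set A.
Proof.
move=> v0 rayA /pinfty_ex_gt0 [M _ hM].
have nv : 0 < `|v| by rewrite normr_gt0.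
pose t := Num.max 1 ((M + 1) / `|v|).
have t1 : 1 <= t by rewrite le_max lexx.
have : `|t *: v| <= M := hM _ (rayA t t1).
rewrite normrZ ger0_norm; last exact: le_trans t1.
have : M + 1 <= t * `|v| by rewrite -ler_pdivrMr// le_max lexx orbT.
lra.
Qed.

(** The union of B and the ray through w is a connected, unbounded subset of the
    complement of S that contains q. *)
Lemma not_enclosed_of_ray S (B : set T) q w : connected B -> B q -> B w -> w != 0 ->
  (forall z, B z -> ~ S z) -> (forall t : R, 1 <= t -> ~ S (t *: w)) -> ~ enclosed S q.
Proof.
move=> cB Bq Bw w0 BS rS [_]; apply: (unbounded_ray w0) => t t1.
pose I := [set t : R | 1 <= t].
pose ray := [set 0 + t *: w | t in I].
have iI : is_interval I.
  by move=> x y /= x1 _ z /andP[xz _]; exact: le_trans xz.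
have cR : connected (B `|` ray).
  apply: connectedU => //; last exact: connected_line.
  by exists w; split => //; exists 1 => /=; [exact: lexx|rewrite scale1r add0r].
have sub : B `|` ray `<=` ~` S.
  by move=> z [/BS//|[s s1 <-]]; rewrite add0r; exact: rS.
apply: (connected_component_max _ sub cR); first by left.
by right; exists t => //; rewrite add0r.
Qed.

Lemma dot_scale (t : R) (v : T) : dot (t *: v) (t *: v) = t ^+ 2 * dot v v.
Proof. by rewrite dotZl dotZr mulrA. Qed.

Lemma dot_gt0_neq0 (v : T) : 0 < dot v v -> v != 0.
Proof.
by move=> h; apply/eqP => v0; move: h; rewrite v0 dot0l ltxx.
Qed.

Lemma not_enclosed_far S (rho : R) q : (forall z, S z -> dot z z <= rho) ->
  0 <= rho -> rho < dot q q -> ~ enclosed S q.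
Proof.
move=> bS rho0 qr.
have q0 : 0 < dot q q by exact: le_lt_trans qr.
have out (t : R) : 1 <= t -> ~ S (t *: q).
  move=> t1 /bS; rewrite dot_scale => h.
  have : dot q q <= t ^+ 2 * dot q q by apply: ler_peMl; [exact: ltW|exact: exprn_ege1].
  by move=> h'; have := lt_le_trans qr (le_trans h' h); rewrite ltxx.
apply: (@not_enclosed_of_ray S [set q] q q) => //.
- exact: connected1.
- exact: dot_gt0_neq0.
- by move=> z ->; have := out 1 (lexx 1); rewrite scale1r.
Qed.

(** Strong convexity of the squared length on the segment from u to v. *)
Lemma dot_convex (t : R) (u v : T) :
  dot (u + t *: (v - u)) (u + t *: (v - u)) =
  (1 - t) * dot u u + t * dot v v - t * (1 - t) * dot (v - u) (v - u).
Proof.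
rewrite !(dotDl, dotDr, dotZl, dotZr, dotNl, dotNr) (dotC u v).
by move: (dot _ _) (dot _ _) (dot _ _) => x y z; ring.
Qed.

(** The segment from q to w stays in the open ball until it reaches w, and the ray
    through w leaves the ball: q escapes through the missing point w. *)
Lemma sphere_filled S (rho : R) q w : (forall z, S z -> dot z z = rho) ->
  dot q q < rho -> dot w w = rho -> ~ S w -> ~ enclosed S q.
Proof.
move=> SS qr wr nSw.
have rho0 : 0 < rho by apply: le_lt_trans qr; exact: dot_ge0.
pose I := [set t : R | 0 <= t <= 1].
have iI : is_interval I.
  move=> x y /= /andP[x0 _] /andP[_ y1] z /andP[xz zy].
  by apply/andP; split; [exact: le_trans xz|exact: le_trans y1].
apply: (@not_enclosed_of_ray S [set q + t *: (w - q) | t in I] q w).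
- exact: connected_line.
- by exists 0; [rewrite /I /= lexx ler01|rewrite scale0r addr0].
- by exists 1; [rewrite /I /= lexx ler01|rewrite scale1r addrC subrK].
- by apply: dot_gt0_neq0; rewrite wr.
- move=> _ [t /= /andP[t0 t1] <-].
  have [->|tn1] := eqVneq t 1; first by rewrite scale1r addrC subrK.
  have {}t1 : t < 1 by rewrite lt_neqAle tn1.
  move=> /SS; rewrite dot_convex wr => h.
  have h1 : 0 <= t * (1 - t) * dot (w - q) (w - q).
    by rewrite !mulr_ge0 ?dot_ge0// subr_ge0 ltW.
  have h2 : (1 - t) * dot q q < (1 - t) * rho by rewrite ltr_pM2l// subr_gt0.
  have : (1 - t) * dot q q + t * rho < rho.
    have e : (1 - t) * rho + t * rho = rho by ring.
    by rewrite -[X in _ < X]e ltrD2r.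
  rewrite -[X in _ < X]h ltNge => /negP; apply.
  by rewrite gerBl.
- move=> t t1 St; have := SS _ St; rewrite dot_scale wr => h.
  have t11 : t = 1.
    have : t ^+ 2 = 1 by apply: (mulIf (lt0r_neq0 rho0)); rewrite h mul1r.
    move/eqP; rewrite sqrf_eq1 => /orP[/eqP//|/eqP tN].
    by move: t1; rewrite tN; lra.
  by apply: nSw; move: St; rewrite t11 scale1r.
Qed.

End Enclosure.

(** * Rigidity *)

Section Scalar.
Context {R : realType}.
Implicit Types c h k x : R.

(** The right-hand side has a double zero at h = k: for k = sqrt c this shows that
    the trace of the cube is largest at k, and makes Gronwall's inequality
    applicable. *)
Lemma cubic_trace_sub c h k : k ^+ 2 = c ->
  cubic_trace c k - cubic_trace c h = (h - k) ^+ 2 * (h + 2 * k) / 2.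
Proof. by move=> <-; rewrite /cubic_trace; field. Qed.

(** Sign of the quantity that appears when the Laplacian of H is multiplied by the
    trace of the cube: it is positive for c < h^2 < 2 c. *)
Lemma cubic_trace_mul c h :
  h * cubic_trace c h - c ^+ 2 = - ((h ^+ 2 - c) * (h ^+ 2 - 2 * c)) / 2.
Proof. by rewrite /cubic_trace; field. Qed.

End Scalar.

Section Global.
Context {R : realType}.
Notation T := 'rV[R]_3.
Variables (S : set T) (n : T -> T).
Hypotheses (emb : embedded_surface S) (nor : outward_unit_normal S n).

Lemma dot_normal_sqr p : S p -> dot p (n p) ^+ 2 <= dot p p.
Proof.
move=> Sp; have [_ nn _ _ _] := nor Sp.
have := dot_ge0 (p - dot p (n p) *: n p).
rewrite !(dotDl, dotDr, dotNl, dotNr, dotZl, dotZr) nn (dotC (n p) p).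
by move: (dot p (n p)) (dot p p) => x y; rewrite expr2; lra.
Qed.

Lemma right_witness (A : set R) : (\forall t \near (0 : R)^'+, A t) ->
  forall d, 0 < d -> exists2 t : R, 0 < t < d & A t.
Proof.
move=> nA d d0.
have [t [[At t0] td]] : exists t, (A t /\ 0 < t) /\ t < d.
  apply: (@filter_ex _ (0 : R)^'+); apply: filterI; last exact: nbhs_right_lt.
  by apply: filterI => //; exact: nbhs_right_gt.
by exists t => //; rewrite t0.
Qed.

(** The derivative of |x|^2 vanishes in tangent directions, so p is a multiple
    s n of the normal.  If s were 0, S would be a point, without tangent vectors
    of length one; if s were negative, the points p - t n for small t > 0 would lie
    beyond p, hence outside the ball containing S, and could not be enclosed. *)
Lemma farthest_normal V N E1 E2 p : adapted_frame S V N E1 E2 -> V p ->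
  (forall q, S q -> V q -> N q = n q) -> S p ->
  (forall q, S q -> dot q q <= dot p p) ->
  0 < dot p (n p) /\ p = dot p (n p) *: n p.
Proof.
move=> af Vp Nn Sp far; have oV := af_open af.
have sF : smooth V (fun z => dot z z) by apply: smooth_dot => //; exact: smooth_id.
have [z1 z2 _] := maximum_hessian emb af sF Sp Vp (fun q Sq _ => far q Sq).
have dF v : 'D_v (fun z => dot z z) p = dot p v + dot p v.
  have did : derivable (id : T -> T) p v by exact: derivable_id.
  have did1 : 'D_v (id : T -> T) p = v by exact: derive_id.
  by apply: (etrans (derive_dot did did)); rewrite did1 dotC.
have {}z1 := etrans (esym (dF _)) z1; have {}z2 := etrans (esym (dF _)) z2.
have orth := af_orth af Sp Vp; rewrite (Nn _ Sp Vp) in orth.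
have e1 : dot p (E1 p) = 0 by lra.
have e2 : dot p (E2 p) = 0 by lra.
have pn : p = dot p (n p) *: n p.
  by rewrite [LHS](orthonormal3_expand p orth) e1 e2 !scale0r !add0r.
split=> //; have [_ nn _ inside _] := nor Sp.
have pp : dot p p = dot p (n p) ^+ 2 by rewrite {1}pn dotZl (dotC (n p)) expr2.
rewrite lt_neqAle; apply/andP; split.
  apply/eqP => s0; have p0 : dot p p = 0 by rewrite pp -s0 expr0n.
  have S0 q : S q -> q = 0.
    by move=> /far; rewrite p0 => q0; apply: dot_eq0; apply/eqP; rewrite eq_le q0 dot_ge0.
  have E0 : E1 p = 0.
    rewrite -(derive_id p (E1 p)) -[RHS](derive_cst (0 : T) p (E1 p)).
    apply: (derive_tangent oV Vp) (af_tan1 af Sp Vp) => [q Sq _||].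
    - exact: S0.
    - exact: ex_diff.
    - exact: differentiable_cst.
  have [[/eqP + _ _] _] := orth.
  by rewrite E0 dot0l eq_sym oner_eq0.
rewrite leNgt; apply/negP => s0.
have [t /andP[t0 _] enc] := right_witness inside ltr01.
apply: (@not_enclosed_far _ S (dot p p) (p - t *: n p) far (dot_ge0 p)) enc.
rewrite !(dotDl, dotDr, dotNl, dotNr, dotZl, dotZr) nn (dotC (n p) p).
have ts : 0 < t * - dot p (n p) by rewrite mulr_gt0// oppr_gt0.
have tt : 0 < t * t by rewrite mulr_gt0.
by move: (dot p p) (dot p (n p)) ts => x y ts; lra.
Qed.

End Global.

Section Final.
Context {R : realType}.
Notation T := 'rV[R]_3.

Lemma sqr_le_bounds (x s : R) : 0 <= s -> x ^+ 2 <= s ^+ 2 -> - s <= x <= s.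
Proof.
by move=> s0 xs; rewrite -ler_norml -(ler_pXn2r (ltn0Sn 1)) ?nnegrE// real_normK// num_real.
Qed.

(** The points just inside S are enclosed, which by [sphere_filled] leaves no
    missing point on the sphere. *)
Lemma sphere_of_constant_support (S : set T) n (s : R) : outward_unit_normal S n -> S !=set0 ->
  0 < s -> (forall q, S q -> dot q q = s ^+ 2 /\ dot q (n q) = s) -> round_sphere S.
Proof.
move=> nor [p Sp] s0 SS; exists 0, s; split => //.
apply/seteqP; split=> w /=; first by move=> /SS[]; rewrite subr0.
rewrite subr0 => ws; apply: contrapT => nSw.
have [_ nn _ inside _] := nor p Sp; have [pp pn] := SS p Sp.
have [t /andP[t0 ts] enc] := right_witness inside s0.
apply: (@sphere_filled _ S (s ^+ 2) (p - t *: n p) w _ _ ws nSw) enc.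
  by move=> z /SS[].
rewrite !(dotDl, dotDr, dotNl, dotNr, dotZl, dotZr) nn (dotC (n p) p) pp pn.
have tt : 0 < t * (s - t) by rewrite mulr_gt0// subr_gt0.
have t1 : 0 < t * s by rewrite mulr_gt0.
lra.
Qed.

Section Rigidity.
Variables (S : set T) (n : T -> T) (lam l : R).
Hypotheses (emb : embedded_surface S) (conn : connected S).
Hypotheses (nor : outward_unit_normal S n) (mc : lambda_hypersurface S n lam).
Hypothesis sl : forall p, S p -> is_second_form_length S n p l.
Local Notation c := (l ^+ 2).
Local Notation h := (support_mean n lam).

Lemma support_mean_extension p : S p -> exists V F,
  [/\ open V, V p, smooth V F & forall q, S q -> V q -> F q = h q].
Proof. by move=> /(gradient_bound emb nor mc sl) [V [F [e _]]]; exists V, F. Qed.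

(** By (1), a bound of the deficit c^2 - c/2 - lambda g(H) by a multiple of
    (H - k)^2 is a bound of the gradient of H - k by a multiple of H - k. *)
Lemma support_mean_rigid C k z : 0 <= C -> S z -> h z = k ->
  (forall q, S q -> 2 * (c ^+ 2 - c / 2 - lam * cubic_trace c (h q)) <= C * (h q - k) ^+ 2) ->
  forall q, S q -> h q = k.
Proof.
move=> C0 Sz hz bound; apply: (constant_of_gradient_bound emb C0 _ conn Sz hz) => p Sp.
have [V [F [e gb]]] := gradient_bound emb nor mc sl Sp.
exists V, F; split => // v tv; apply: le_trans (gb v tv) _.
by apply: ler_wpM2r; [exact: dot_ge0|exact: bound].
Qed.

(** See the overview above: (1) at z and at p, together with the signs of the
    Laplacian there, put sqrt c between H(z) and H(p). *)
Lemma support_mean_constant p z : 0 <= lam -> S p -> S z -> 0 < h p ->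
  (forall q, S q -> h q <= h p) -> (forall q, S q -> h z <= h q) ->
  h z ^+ 2 < 2 * c -> forall q, S q -> h q = h p.
Proof.
move=> lam0 Sp Sz m0 hmax hmin nonumb.
have [critz lapz] := minimum_point emb nor mc sl Sz hmin.
have [critp lapp] := maximum_point emb nor mc sl Sp hmax.
have {critz}gz := critz nonumb.
have c0 : 0 < c.
  have := umbilic_bound emb nor mc sl Sp.
  have := exprn_gt0 2 m0; move: (h p ^+ 2) => x; lra.
have [lam00|lamn0] := eqVneq lam 0.
  have zero : c ^+ 2 - c / 2 = 0 by rewrite gz lam00 mul0r.
  apply: (@support_mean_rigid 0 (h p) p) => // q Sq.
  by rewrite lam00 !mul0r subr0 zero mulr0.
have {lamn0 lam0}lam0 : 0 < lam by rewrite lt_neqAle eq_sym lamn0.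
have gp : lam * cubic_trace c (h p) <= c ^+ 2 - c / 2.
  by rewrite -subr_ge0; exact: (deficit_ge0 emb nor mc sl Sp).
have cp0 : 0 < cubic_trace c (h p).
  have ub := umbilic_bound emb nor mc sl Sp.
  rewrite /cubic_trace; apply: divr_gt0 => //; apply: mulr_gt0 => //.
  by move: ub c0; lra.
have cz0 : 0 < c ^+ 2 - c / 2 by apply: lt_le_trans gp; exact: mulr_gt0.
have ch : 0 < c - 2^-1.
  have : 0 < c * (c - 2^-1) by move: cz0; rewrite expr2 mulrBr.
  by rewrite pmulr_rgt0.
have gz0 : 0 < cubic_trace c (h z) by rewrite -(pmulr_rgt0 _ lam0) -gz.
have x0 : 0 < h z.
  have e : 0 < (3 * c - h z ^+ 2) / 2 by move: nonumb c0; lra.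
  move: gz0; rewrite /cubic_trace -mulrA.
  by rewrite pmulr_lgt0.
(* Multiplied by g > 0 and combined with (1), the sign of the Laplacian becomes a
   comparison of h g(h) with c^2. *)
have xc : h z ^+ 2 <= c.
  have h1 : h z * cubic_trace c (h z) <= c ^+ 2.
    rewrite -(ler_pM2l ch).
    have -> : (c - 2^-1) * (h z * cubic_trace c (h z)) = ((c - 2^-1) * h z) * cubic_trace c (h z) by ring.
    have -> : (c - 2^-1) * c ^+ 2 = (c * lam) * cubic_trace c (h z).
      by rewrite -mulrA -gz; ring.
    by apply: ler_wpM2r; [exact: ltW|move: lapz; lra].
  have := cubic_trace_mul c (h z); move: h1; rewrite -subr_le0 => h1 e.
  rewrite e in h1; rewrite leNgt; apply/negP => cx.
  have : (h z ^+ 2 - c) * (h z ^+ 2 - 2 * c) < 0.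
    by rewrite pmulr_rlt0 ?subr_gt0// subr_lt0.
  by move: h1; lra.
have cm : c <= h p ^+ 2.
  rewrite leNgt; apply/negP => mc'.
  have mc2 : h p ^+ 2 < 2 * c by move: mc' c0; lra.
  have {critp}gp' := critp mc2.
  have h1 : c ^+ 2 <= h p * cubic_trace c (h p).
    rewrite -(ler_pM2l ch).
    have -> : (c - 2^-1) * (h p * cubic_trace c (h p)) = ((c - 2^-1) * h p) * cubic_trace c (h p) by ring.
    have -> : (c - 2^-1) * c ^+ 2 = (c * lam) * cubic_trace c (h p).
      by rewrite -mulrA -gp'; ring.
    by apply: ler_wpM2r; [exact: ltW|move: lapp; lra].
  have := cubic_trace_mul c (h p); move: h1; rewrite -subr_ge0 => h1 e.
  rewrite e in h1.
  have : 0 < (h p ^+ 2 - c) * (h p ^+ 2 - 2 * c) by rewrite nmulr_rgt0 ?subr_lt0.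
  by move: h1; lra.
pose k := Num.sqrt c.
have k0 : 0 < k by rewrite sqrtr_gt0.
have kc : k ^+ 2 = c by rewrite sqr_sqrtr// ltW.
have zk : h z <= k by have := @sqr_le_bounds (h z) k (ltW k0); rewrite kc => /(_ xc)/andP[].
have kp : k <= h p by have := @sqr_le_bounds k (h p) (ltW m0); rewrite kc => /(_ cm)/andP[].
have zkp : h z <= k <= h p by rewrite zk kp.
have [y Sy hy] := intermediate_value support_mean_extension conn Sz Sp zkp.
(* Between deficit_ge0 at y and (1) at z, the maximality of g at k leaves equality. *)
have gk : lam * cubic_trace c k = c ^+ 2 - c / 2.
  have := deficit_ge0 emb nor mc sl Sy; rewrite hy subr_ge0 => le1.
  apply/eqP; rewrite eq_le le1 gz /= ler_pM2l// -subr_ge0 cubic_trace_sub//.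
  apply: divr_ge0 => //; apply: mulr_ge0; first exact: sqr_ge0.
  by apply: addr_ge0; [exact: ltW|exact: mulr_ge0 (ler0n _ 2) (ltW k0)].
have hk : forall q, S q -> h q = k.
  apply: (@support_mean_rigid (lam * (h p + 2 * k)) k y) => //.
    by apply: mulr_ge0; [exact: ltW|apply: addr_ge0; [exact: ltW|exact: mulr_ge0 (ler0n _ 2) (ltW k0)]].
  move=> q Sq; rewrite -gk -mulrBr cubic_trace_sub//.
  have -> : 2 * (lam * ((h q - k) ^+ 2 * (h q + 2 * k) / 2)) =
    lam * (h q + 2 * k) * (h q - k) ^+ 2 by field.
  apply: ler_wpM2r; first exact: sqr_ge0.
  by rewrite ler_pM2l// lerD2r; exact: hmax.
by move=> q Sq; rewrite !hk.
Qed.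

End Rigidity.

End Final.

Theorem theorem1p4 (R : realType) (lambda : R) (S : set 'rV[R]_3)
    (n : 'rV[R]_3 -> 'rV[R]_3) :
  0 <= lambda ->
  closed_embedded_surface S ->
  outward_unit_normal S n ->
  lambda_hypersurface S n lambda ->
  (exists a : R, forall p, S p -> is_second_form_length S n p a) ->
  round_sphere S.
Proof.
move=> lam0 [emb cpt conn ne] nor mc [l sl].
pose h := support_mean n lambda.
have dot_ext (p : 'rV[R]_3) : S p -> exists V F,
    [/\ open V, V p, smooth V F & forall q, S q -> V q -> F q = dot q q].
  move=> _; exists setT, (fun z : 'rV[R]_3 => dot z z); split => //; first exact: openT.
  by apply: smooth_dot; [exact: openT|apply: smooth_id; exact: openT..].
have [p pS far] := compact_EVT_max ne cpt (extension_continuous dot_ext).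
have Sp : S p by rewrite inE in pS.
have {}far q : S q -> dot q q <= dot p p by move=> Sq; apply: far; rewrite inE.
have frame q := adapted_frame_at nor mc (p := q).
have normal_far q : S q -> (forall z, S z -> dot z z <= dot q q) ->
    0 < dot q (n q) /\ dot q q = dot q (n q) ^+ 2.
  move=> Sq farq; have [V [N [E1 [E2 [af Vq Nn]]]]] := frame q Sq.
  have [s0 qn] := farthest_normal emb nor af Vq Nn Sq farq.
  by split => //; rewrite {1}qn dotZl (dotC (n q)) expr2.
have [s0 pp] := normal_far p Sp far.
set s := dot p (n p) in s0 pp.
have bounds q : S q -> - s <= dot q (n q) <= s.
  move=> Sq; apply: sqr_le_bounds; first exact: ltW.
  by rewrite -pp; apply: le_trans (far q Sq); exact: (dot_normal_sqr nor Sq).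
have hmax q : S q -> h q <= h p.
  by move=> /bounds /andP[_ qs]; rewrite /h /support_mean -/s lerD2l ler_pM2r.
have m0 : 0 < h p by rewrite /h /support_mean -/s ltr_wpDl// divr_gt0.
have [z zS hmin] := compact_EVT_min ne cpt
  (extension_continuous (support_mean_extension emb nor mc sl)).
have Sz : S z by rewrite inE in zS.
have {}hmin q : S q -> h z <= h q by move=> Sq; apply: hmin; rewrite inE.
have const : forall q, S q -> h q = h p.
  have := umbilic_bound emb nor mc sl Sz; rewrite le_eqVlt => /orP[/eqP umb|]; last first.
    exact: support_mean_constant lam0 Sp Sz m0 hmax hmin.
  have [zp q Sq|zp] := eqVneq (h z) (h p).
    by apply/eqP; rewrite eq_le hmax// -zp hmin.
  have {}zp : h z < h p by rewrite lt_neqAle zp hmax.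
  (* Here h z = - sqrt (2 c), while h p <= sqrt (2 c). *)
  have hz : h z <= - h p.
    have : 0 <= (h z - h p) * (h z + h p).
      rewrite -subr_sqr subr_ge0 umb; exact: (umbilic_bound emb nor mc sl Sp).
    by rewrite nmulr_rge0 ?subr_lt0// => hh; rewrite -subr_le0 opprK.
  have /andP[zs _] := bounds z Sz.
  have zn : dot z (n z) = - s.
    move: hz; rewrite /h /support_mean -/s => hz.
    by apply/eqP; rewrite eq_le zs andbT; move: hz lam0; lra.
  have zz : dot p p <= dot z z.
    by rewrite pp -sqrrN -zn; exact: (dot_normal_sqr nor Sz).
  have [] := normal_far z Sz (fun q Sq => le_trans (far q Sq) zz).
  by rewrite zn oppr_gt0 ltNge ltW.
apply: (sphere_of_constant_support nor ne s0) => q Sq.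
have qn : dot q (n q) = s.
  by have := const q Sq; rewrite /h /support_mean -/s => /addrI /(mulIf _); apply; rewrite invr_eq0 pnatr_eq0.
split => //; apply/eqP; rewrite eq_le -{1}pp far//= -qn.
exact: (dot_normal_sqr nor Sq).
Qed.
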